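(* Let $S=\operatorname{PSL}(2,q)$ with $q=p^n\geq 5$, where $p$ is a prime and $n\geq 1$ is an integer, and let $G$ be an almost simple group with socle $S$, so that $S\leq G\leq\operatorname{Aut}(S)$. Then $\mathcal{E}^{**}(G)$ is claw-free if and only if $S\leq G\leq\operatorname{PGL}(2,q)$.
   Context: For a finite group $G$, the enhanced power graph $\mathcal{E}(G)$ is the graph with vertex set $G$ in which two distinct vertices $u,v$ are adjacent if and only if $\langle u,v\rangle$ is cyclic. A vertex is dominating if it is adjacent to all other vertices. The proper enhanced power graph $\mathcal{E}^{**}(G)$ is the subgraph of $\mathcal{E}(G)$ induced on the non-dominating vertices. A graph is claw-free if it has no induced subgraph isomorphic to $K_{1,3}$. Here $\operatorname{Aut}(S)=\operatorname{P\Gamma L}(2,q)=\operatorname{PGL}(2,q)\rtimes\langle\varphi\rangle$, with $\varphi$ the standard field automorphism of order $n$, and $S$ and $\operatorname{PGL}(2,q)$ are regarded as subgroups of $\operatorname{Aut}(S)$. *)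

(* Defs.v *)
From HB Require Import structures.
From mathcomp Require Import all_boot all_order all_algebra.
From mathcomp Require Import all_fingroup all_solvable.

Set Implicit Arguments.
Unset Strict Implicit.
Unset Printing Implicit Defensive.

Local Open Scope group_scope.

(** * Graphs *)

(* Only the restriction of [adj] to [vertices] is meaningful. *)
Record graph (T : finType) := Graph { vertices : {set T}; adj : rel T }.

Definition dominating (T : finType) (Gr : graph T) (v : T) : bool :=
  (v \in vertices Gr) &&
  [forall u in vertices Gr, (u != v) ==> adj Gr v u].

Definition induced_subgraph (T : finType) (Gr : graph T) (A : {set T}) :
    graph T :=
  Graph (vertices Gr :&: A) (adj Gr).

Definition induced_copy (T U : finType) (Gr : graph T) (H : graph U)
    (f : U -> T) : Prop :=
  [/\ {in vertices H &, injective f},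
      {in vertices H, forall a, f a \in vertices Gr} &
      {in vertices H &, forall a b, adj Gr (f a) (f b) = adj H a b}].

Definition complete_bipartite (m n : nat) : graph ('I_m + 'I_n)%type :=
  Graph [set: 'I_m + 'I_n] (fun a b => is_inl a != is_inl b).

Definition claw_free (T : finType) (Gr : graph T) : Prop :=
  ~ exists f, induced_copy Gr (complete_bipartite 1 3) f.

(** * Enhanced power graphs *)

Definition enhanced_power_graph (gT : finGroupType) (G : {set gT}) : graph gT :=
  Graph G (fun u v => (u != v) && cyclic <<[set u; v]>>).

Definition proper_enhanced_power_graph (gT : finGroupType) (G : {set gT}) :
    graph gT :=
  let E := enhanced_power_graph G in
  induced_subgraph E [set v in G | ~~ dominating E v].

(** * Two-dimensional linear groups *)

Section LinearGroups.

Variable F : finFieldType.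

Definition SL2 : {set {'GL_2[F]}} :=
  [set u : {'GL_2[F]} | (\det (GLval u) == 1)%R].

Lemma SL2_group_set : group_set SL2.
Proof.
apply/group_setP; split=> [|u v]; first by rewrite inE GL_1E det1.
by rewrite !inE GL_ME det_mulmx => /eqP-> /eqP->; rewrite GRing.mulr1.
Qed.

Canonical SL2_group := Group SL2_group_set.

(* PGL(2,F) is GL(2,F) modulo its centre, and PSL(2,F) is the image of SL(2,F)
   in it, so that both live in the same type. *)
Definition PGL2 : {group coset_of 'Z('GL_2[F])} := ('GL_2[F] / 'Z('GL_2[F]))%G.
Definition PSL2 : {group coset_of 'Z('GL_2[F])} := (SL2 / 'Z('GL_2[F]))%G.

Lemma PSL2_normal : PSL2 <| PGL2.
Proof.
apply: quotient_normal; apply/andP; split; first exact: subsetT.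
apply/subsetP=> g _; rewrite inE; apply/subsetP=> _ /imsetP[u + ->].
rewrite !inE /conjg !GL_ME => /eqP du.
by rewrite !det_mulmx du GRing.mul1r -det_mulmx -GL_MxE mulVg GL_1E det1.
Qed.

(* The copies of PSL(2,F) and PGL(2,F) inside Aut(PSL(2,F)): x is sent to the
   automorphism y |-> y ^ x of PSL(2,F). By [PSL2_normal] the group PGL(2,F) lies
   in the domain 'N(PSL2) of the morphism [conj_aut PSL2]. *)
Definition PSL2_in_Aut : {group {perm coset_of 'Z('GL_2[F])}} :=
  (conj_aut PSL2 @* PSL2)%G.
Definition PGL2_in_Aut : {group {perm coset_of 'Z('GL_2[F])}} :=
  (conj_aut PSL2 @* PGL2)%G.

End LinearGroups.

(* Main.v *)
(** Write q = p^n, S = PSL(2,q).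

    If G <= PGL(2,q), adjacency is transitive on the non-identity elements. Lift
    u <> 1 to a matrix A; an element w with u in <w> lifts to the centralizer
    F[A]^* of A. If A has no eigenvalue in F, F[A]^* is cyclic; if A is
    diagonalizable with distinct eigenvalues, F[A]^*/F^* is isomorphic to F^*; if
    A is unipotent up to a scalar, F[A]^*/F^* has exponent p and so <w> = <u>. In
    each case all the neighbours of u lie in one cyclic group.

    Conversely, every automorphism of S has the form A |-> (A^s)^g with s a field
    automorphism and g in GL(2,q): after conjugation it preserves the upper and
    the lower unipotent Sylow p-subgroups and fixes the upper transvection of
    parameter 1; its action x |-> f(x) on parameters is additive, and the
    relation diag(x,1/x) upper(y) diag(x,1/x)^-1 = upper(x^2 y) gives
    f(x^2 y) = f(x)^2 f(y), whence f is multiplicative. So if G is not inside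
    PGL(2,q), some beta in G acts as (s, g) with s of prime order r.
    - If r is odd, or det g is a square, G contains an element of order r acting
      as s alone. It centralizes S(F^s), and is the centre of a claw whose leaves
      have order prime to r in S(F^s): three involutions (r odd), three
      transvections (r = 2, p odd) or three conjugates of diag(t,1/t) (r = 2 = p,
      where q > 4 provides t in F^s outside the prime field).
    - If r = 2 and det g is not a square, G contains a quaternion group of order
      8: its involution is the centre and generators of its three cyclic
      subgroups of order 4 are the leaves. *)

From HB Require Import structures.
Require Import Defs.
From mathcomp Require Import all_boot all_order all_algebra.
From mathcomp Require Import all_fingroup all_solvable.
From mathcomp Require Import finfield zify ring.

Set Implicit Arguments.
Unset Strict Implicit.
Unset Printing Implicit Defensive.

Import GRing.Theory.
Local Open Scope ring_scope.

(** * Finite fields *)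

Section FiniteField.

Variable F : finFieldType.
Implicit Types (x y k : F).

Lemma finField_primitive_root :
  exists z : F, [/\ z != 0, forall x, x != 0 -> exists i, x = z ^+ i &
    forall i, z ^+ i = 1 -> (#|F|.-1 %| i)%N].
Proof.
have /cyclicP[g eg] := field_unit_group_cyclic [set: {unit F}]%G.
exists (val g); split=> [|x|i]; first by rewrite -unitfE (valP g).
  rewrite -unitfE => Ux.
  have : FinRing.unit F Ux \in <[g]>%g by rewrite -eg inE.
  case/cycleP=> i ei; exists i.
  by rewrite -[LHS]/(val (FinRing.unit F Ux)) ei FinRing.val_unitX.
rewrite -FinRing.val_unitX -card_finField_unit => gi1.
rewrite eg -orderE order_dvdn.
by apply/eqP/val_inj.
Qed.

(** A non-square is an odd power of a generator of F^*, and two odd exponents add up to an even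
    one. *)
Lemma square_nonsquare x y : x != 0 -> y != 0 ->
  (forall k, x != k * k) -> (forall k, y != k * k) -> exists k, x * y = k * k.
Proof.
move=> nzx nzy nx ny; have [z [nzz prim _]] := finField_primitive_root.
have odd_exp a i : a = z ^+ i -> (forall k, a != k * k) -> odd i.
  move=> ea na; apply: contraT => ev; have := na (z ^+ i./2).
  by rewrite -exprD addnn even_halfK // ea eqxx.
have [i ei] := prim x nzx; have [j ej] := prim y nzy.
have oi := odd_exp _ _ ei nx; have oj := odd_exp _ _ ej ny.
exists (z ^+ (i + j)./2); rewrite -exprD addnn even_halfK ?oddD ?oi ?oj //.
by rewrite exprD ei ej.
Qed.

Lemma square_dec x : (exists k, x = k * k) \/ (forall k, x != k * k).
Proof.
case: (pickP [pred k | x == k * k]) => [k /eqP e|h]; first by left; exists k.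
by right=> k; rewrite (negbT (h k)).
Qed.

Lemma card_finField_exp_gt0 p n : #|F| = (p ^ n)%N -> (0 < n)%N.
Proof.
by case: n => // F1; have := card_finNzRing_gt1 F; rewrite F1 expn0.
Qed.

Lemma card_pow2_square n x : #|F| = (2 ^ n)%N -> exists r, x = r * r.
Proof.
move=> cF; exists (x ^+ (2 ^ n.-1)).
rewrite -exprD addnn -mul2n -expnS prednK ?(card_finField_exp_gt0 cF) //.
by rewrite -cF expf_card.
Qed.

Lemma square_additive_morphism p n (f : F -> F) : prime p -> #|F| = (p ^ n)%N ->
  {morph f : x y / x + y} -> f 1 = 1 ->
  (forall x y, f (x * x * y) = f x * f x * f y) ->
  exists s : {rmorphism F -> F}, s =1 f.
Proof.
move=> p_pr cF fD f1 fQ.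
have f0 : f 0 = 0 by apply: (addrI (f 0)); rewrite -fD !addr0.
have fN x : f (- x) = - f x by apply: (addrI (f x)); rewrite -fD !subrr.
have fB : zmod_morphism f by move=> x y; rewrite fD fN.
have fM : {morph f : x y / x * y}.
  (* In characteristic 2, x = r^2, and the hypothesis at y = 1 identifies f(r)^2 with f(x). *)
  move=> x y; have [p2|np2] := eqVneq p 2%N.
    have [r ->] : exists r, x = r * r.
      by apply: (@card_pow2_square n); rewrite -p2.
    by rewrite fQ; have := fQ r 1; rewrite mulr1 f1 mulr1 => ->.
  have nz2 : (2 : F) != 0.
    have chF := card_finPcharP cF p_pr.
    by rewrite -(dvdn_pcharf chF) dvdn_prime2.
  (* In odd characteristic, polarize: replace x by x + 1 in fQ. *)
  have := fQ (x + 1) y.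
  have -> : (x + 1) * (x + 1) * y = x * x * y + (x * y + x * y) + 1 * 1 * y by ring.
  rewrite 3!fD !fQ fD f1 => e.
  apply: (mulfI nz2).
  apply: (addrI (f x * f x * f y + 1 * 1 * f y)).
  have -> : 2 * f (x * y) = f (x * y) + f (x * y) by ring.
  have := e.
  have -> : (f x + 1) * (f x + 1) * f y =
    f x * f x * f y + 1 * 1 * f y + 2 * (f x * f y) by ring.
  by move=> <-; ring.
pose s1 := GRing.isZmodMorphism.Build F F f fB.
pose s2 := GRing.isMonoidMorphism.Build F F f (conj f1 fM).
by exists (HB.pack_for {rmorphism F -> F} f s1 s2).
Qed.

Lemma char2_sqr_eq1 x : 2%N \in [pchar F] -> x * x = 1 -> x = 1.
Proof.
move=> ch2 xx; apply/eqP; rewrite -subr_eq0 -[_ == 0]orbb -mulf_eq0; apply/eqP.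
have -> : (x - 1) * (x - 1) = x * x + 1 - 2 * x by ring.
by rewrite xx (pcharf0 ch2) mul0r subr0 -mulr2n -mulr_natr (pcharf0 ch2) mulr0.
Qed.

End FiniteField.

Lemma odd_sqr_pred8 m : odd m -> (8 %| (m ^ 2).-1)%N.
Proof.
move=> om; rewrite -[m]odd_double_half om; move: m./2 => i.
have -> : ((true + i.*2) ^ 2).-1 = (4 * (i * i.+1))%N by rewrite -mulnn; lia.
by rewrite -[8%N]/(4 * 2)%N dvdn_pmul2l // dvdn2 oddM /= andbN.
Qed.

(** * Involutive automorphisms of a finite field *)

Section Involution.

Variables (F : finFieldType) (s : {rmorphism F -> F}).
Hypotheses (s_neq_id : ~ s =1 id) (sK : involutive s) (nz2 : (2 : F) != 0).
Implicit Types x y a b : F.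

Local Notation F0 := ([set x : F | s x == x] : {set F}).

Lemma antifixed : exists2 b, b != 0 & s b = - b.
Proof.
have [x nx] : exists x, s x != x.
  by apply/existsP; apply: contra_notT s_neq_id => /existsPn h x; apply/eqP/negPn/h.
by exists (s x - x); rewrite ?subr_eq0 // rmorphB sK opprB.
Qed.

(** With [b] antifixed, F is the direct sum of F0 and b F0: (w + s w)/2 is the fixed part of w and
    (w - s w)/2 the antifixed one. *)
Lemma card_fixed_sqr : #|F| = (#|F0| ^ 2)%N.
Proof.
have [b nzb sb] := antifixed.
have s2 : s 2 = 2 by rewrite rmorph_nat.
rewrite expnS expn1 -cardsX -cardsT.
pose f (z : F * F) := z.1 + b * z.2.
have <- : f @: setX F0 F0 = [set: F].
  apply/setP=> w; rewrite inE; apply/imsetP.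
  exists ((w + s w) / 2, (w - s w) / (2 * b)); last by rewrite /f /=; field; rewrite nzb.
  rewrite !inE /= !fmorph_div rmorphD rmorphB rmorphM sK s2 sb.
  by apply/andP; split; apply/eqP; field; rewrite ?oppr_eq0 ?nzb ?nz2.
apply: card_in_imset => -[x y] [x' y'] /=.
rewrite !inE /= => /andP[/eqP sx /eqP sy] /andP[/eqP sx' /eqP sy']; rewrite /f /= => e.
have e' : x - b * y = x' - b * y'.
  by have := congr1 s e; rewrite !rmorphD !rmorphM sx sy sx' sy' sb !mulNr.
have ex : x = x'.
  apply: (mulfI nz2); have -> : 2 * x = (x + b * y) + (x - b * y) by ring.
  by rewrite e e'; ring.
by rewrite ex in e *; move/addrI/(mulfI nzb): e => ->.
Qed.

Lemma minus1_sum_of_squares : exists x y, [/\ s x = x, s y = y & x * x + y * y = -1].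
Proof.
pose A : {set F} := [set x * x | x in F0].
pose B : {set F} := [set - 1 - z | z in A].
have [|/set0Pn[_ /setIP[/imsetP[x Fx ->] /imsetP[_ /imsetP[y Fy ->] e]]]] :=
    eqVneq (A :&: B) set0; last first.
  move: Fx Fy; rewrite !inE => /eqP sx /eqP sy; exists x, y; split=> //.
  by rewrite e; ring.
(* Otherwise the squares of F0 and the elements -1 - x^2 are disjoint in F0; but
   there are more than #|F0| / 2 squares, as F0 is covered by the two square
   root functions rt and -rt, which agree at 0. *)
move=> AB0; exfalso.
have AF : A \subset F0.
  apply/subsetP=> _ /imsetP[x + ->]; rewrite !inE => /eqP sx.
  by rewrite rmorphM sx.
have BF : B \subset F0.
  apply/subsetP=> _ /imsetP[z /(subsetP AF) + ->]; rewrite !inE => /eqP sz.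
  by rewrite rmorphB rmorphN rmorph1 sz.
have cB : #|B| = #|A| by apply: card_in_imset => x y _ _ /addrI /oppr_inj.
have le1 : (#|A| + #|A| <= #|F0|)%N.
  rewrite -{2}cB -cardsUI AB0 cards0 addn0 subset_leq_card //.
  by rewrite subUset AF BF.
(* The default 0 is never reached: [rt] is applied only to elements of [A], which are squares. *)
pose rt a := odflt 0 [pick r : F | r * r == a].
have rtE x : rt (x * x) * rt (x * x) = x * x.
  by rewrite /rt; case: pickP => [r /eqP //|/(_ x)]; rewrite eqxx.
pose P : {set F} := rt @: A; pose N : {set F} := (fun a => - rt a) @: A.
have FU : F0 \subset P :|: N.
  apply/subsetP=> x Fx; have Ax : x * x \in A by apply: imset_f.
  rewrite inE; have := rtE x; move/eqP; rewrite -subr_eq0 -!expr2 subr_sqr mulf_eq0.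
  rewrite subr_eq0 addr_eq0 => /orP[] /eqP e; apply/orP; [left|right];
    by apply/imsetP; exists (x * x); rewrite // -expr2 e ?opprK.
have zI : 0 \in P :&: N.
  have A0 : 0 * 0 \in A by apply: imset_f; rewrite inE rmorph0.
  have r0 : rt (0 * 0) = 0 by have /eqP := rtE 0; rewrite mul0r mulf_eq0 orbb => /eqP.
  by apply/setIP; split; apply/imsetP; exists (0 * 0); rewrite ?r0 ?oppr0.
have I0 : (0 < #|P :&: N|)%N by rewrite card_gt0; apply/set0Pn; exists 0.
have lP : (#|P| <= #|A|)%N by apply: leq_imset_card.
have lN : (#|N| <= #|A|)%N by apply: leq_imset_card.
have l2 : (#|A| + #|A| <= #|P :|: N|)%N := leq_trans le1 (subset_leq_card FU).
have l1 := leq_add lP lN; rewrite -cardsUI in l1.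
by have := leq_trans l1 l2; rewrite -{2}[#|P :|: N|]addn0 leq_add2l leqNgt I0.
Qed.

(** By [card_fixed_sqr], q is the square of an odd number, so 8 divides q - 1 and a generator of F^*
    has a power of order 8. *)
Lemma eighth_root_of_unity : odd #|F| -> exists z : F, z ^+ 4 = -1.
Proof.
move=> oF; have [z [nzz _ ordz]] := finField_primitive_root F.
have /dvdnP[m em] : (8 %| #|F|.-1)%N.
  by rewrite card_fixed_sqr odd_sqr_pred8 //; move: oF; rewrite card_fixed_sqr oddX.
exists (z ^+ m); rewrite -exprM.
have F1 := card_finNzRing_gt1 F.
have m_gt0 : (0 < m)%N by case: m em F1 => //; case: #|F| => [|[|]].
have : (z ^+ (m * 4)) ^+ 2 = 1.
  rewrite -exprM -mulnA -em; apply: (mulfI nzz).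
  by rewrite -exprS prednK ?expf_card ?mulr1 // ltnW.
move/eqP; rewrite sqrf_eq1 => /orP[/eqP/ordz|/eqP //].
rewrite em => /dvdn_leq; rewrite muln_gt0 m_gt0 => /(_ isT).
by rewrite leq_pmul2l.
Qed.

Lemma fixed_not_prime_field : 2%N \in [pchar F] -> (4 < #|F|)%N ->
  exists t : F, [/\ s t = t, t != 0 & t != 1].
Proof.
move=> ch2 F4.
have [[t h]|no] : (exists t : F, [&& s t == t, t != 0 & t != 1]) \/
    (forall t : F, s t = t -> t = 0 \/ t = 1).
  case: (pickP [pred t : F | [&& s t == t, t != 0 & t != 1]]) => [t h|h].
    by left; exists t.
  right=> t st; have := h t; rewrite /= st eqxx /=.
  by case: eqP => [|_] //=; [left | case: eqP => // ; right].
  by case/and3P: h => /eqP st t0 t1; exists t.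
have char2 (x : F) : x + x = 0 by rewrite -mulr2n -mulr_natr (pcharf0 ch2) mulr0.
(* Were F0 the prime field, x would be a root of X^2 - (x + s x) X + x (s x), with
   coefficients 0 or 1, for every x; all roots of these satisfy x^4 = x. *)
have x4 (x : F) : x ^+ 4 = x.
  have ss : s (s x) = x := sK x.
  have q : x * x = (x + s x) * x - x * s x by ring.
  have neg (y : F) : - y = y by apply: (addrI y); rewrite subrr char2.
  have h1 : s (x + s x) = x + s x by rewrite rmorphD ss addrC.
  have h2 : s (x * s x) = x * s x by rewrite rmorphM ss mulrC.
  have -> : x ^+ 4 = (x * x) * (x * x) by ring.
  case: (no _ h1) (no _ h2) q => -> [] -> q.
  + have /eqP : x * x = 0 by rewrite q mul0r subrr.
    by rewrite mulf_eq0 orbb => /eqP ->; rewrite !mul0r.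
  + have x1 : x = 1 by apply: char2_sqr_eq1 => //; rewrite q mul0r sub0r neg.
    by rewrite x1 !mulr1.
  + by rewrite q mul1r subr0 q mul1r subr0.
  + rewrite q mul1r; have -> : (x - 1) * (x - 1) = x * x + 1 - (x + x) by ring.
    by rewrite q mul1r subrK char2 subr0.
(* A polynomial of degree 4 cannot vanish at more than 4 elements. *)
have sz : size ('X^4 - 'X : {poly F}) = 5%N.
  by rewrite size_polyDl ?size_polyXn // size_polyN size_polyX.
have nzp : ('X^4 - 'X : {poly F}) != 0 by rewrite -size_poly_eq0 sz.
have all4 : all (root ('X^4 - 'X : {poly F})) (enum F).
  by apply/allP=> x _; rewrite rootE !hornerE x4 subrr.
by have := max_poly_roots nzp all4 (enum_uniq F); rewrite sz -cardE ltnS leqNgt F4.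
Qed.

End Involution.

(** * Coordinates in GL(2,F) and PGL(2,F) *)

Section Coordinates.

Variable F : finFieldType.
Implicit Types (a b c d k x y : F) (u v : {'GL_2[F]}).

Definition mx2 a b c d : 'M[F]_2 :=
  \matrix_(i, j) (if i == 0 then (if j == 0 then a else b)
                  else (if j == 0 then c else d)).

Lemma mx2_eta (M : 'M[F]_2) : M = mx2 (M 0 0) (M 0 1) (M 1 0) (M 1 1).
Proof.
apply/matrixP=> i j; rewrite mxE.
by case: i => [[|[|?]] ?] //; case: j => [[|[|?]] ?] //=; congr (M _ _);
  apply/val_inj.
Qed.

Lemma mx2_inj a b c d a' b' c' d' :
  mx2 a b c d = mx2 a' b' c' d' -> [/\ a = a', b = b', c = c' & d = d'].
Proof.
by move=> /matrixP e; split; [move: (e 0 0)|move: (e 0 1)|move: (e 1 0)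
  |move: (e 1 1)]; rewrite !mxE.
Qed.

Lemma mulmx2 a b c d a' b' c' d' :
  mx2 a b c d *m mx2 a' b' c' d' =
  mx2 (a * a' + b * c') (a * b' + b * d') (c * a' + d * c') (c * b' + d * d').
Proof.
rewrite [LHS]mx2_eta.
by congr mx2; rewrite !mxE !big_ord_recl big_ord0 addr0 !mxE.
Qed.

Lemma scalemx2 k a b c d : k *: mx2 a b c d = mx2 (k * a) (k * b) (k * c) (k * d).
Proof. by rewrite [LHS]mx2_eta !mxE. Qed.

Lemma addmx2 a b c d a' b' c' d' :
  mx2 a b c d + mx2 a' b' c' d' = mx2 (a + a') (b + b') (c + c') (d + d').
Proof. by rewrite [LHS]mx2_eta !mxE. Qed.

Lemma mx2_scalar k : k%:M = mx2 k 0 0 k.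
Proof. by rewrite [LHS]mx2_eta !mxE. Qed.

Lemma det_mx2 a b c d : \det (mx2 a b c d) = a * d - b * c.
Proof.
rewrite (expand_det_row _ 0) !big_ord_recl big_ord0 addr0 /cofactor.
by rewrite !det_mx11 !mxE /= expr0 expr1 mul1r mulN1r mulrN.
Qed.

(* Junk value: gl a b c d = 1 when a * d - b * c = 0. *)
Definition gl a b c d : {'GL_2[F]} := insubd (1%g : {'GL_2[F]}) (mx2 a b c d).

Lemma glE a b c d : a * d - b * c != 0 -> GLval (gl a b c d) = mx2 a b c d.
Proof.
move=> nz; apply: (insubdK (1%g : {'GL_2[F]})).
by rewrite -topredE /= unitmxE det_mx2 unitfE.
Qed.

Lemma GLval_inj : injective (@GLval 2 F).
Proof. exact: val_inj. Qed.

Variant gl_spec u : Prop :=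
  GlSpec a b c d of a * d - b * c != 0 & u = gl a b c d.

Lemma glP u : gl_spec u.
Proof.
have eu := mx2_eta (GLval u).
have nz := GL_det u; rewrite eu det_mx2 in nz.
by apply: (GlSpec nz); apply/GLval_inj; rewrite glE.
Qed.

Lemma glM a b c d a' b' c' d' :
  a * d - b * c != 0 -> a' * d' - b' * c' != 0 ->
  (gl a b c d * gl a' b' c' d')%g =
  gl (a * a' + b * c') (a * b' + b * d') (c * a' + d * c') (c * b' + d * d').
Proof.
move=> nz nz'; apply/GLval_inj; rewrite GL_MxE !glE ?mulmx2 //.
have := mulf_neq0 nz nz'; congr (_ != 0); ring.
Qed.

Lemma gl1 : gl 1 0 0 1 = 1%g.
Proof.
apply/GLval_inj; rewrite glE ?mulr1 ?mulr0 ?subr0 ?oner_eq0 //.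
by rewrite -mx2_scalar.
Qed.

Lemma gl_inj a b c d a' b' c' d' :
  a * d - b * c != 0 -> a' * d' - b' * c' != 0 ->
  gl a b c d = gl a' b' c' d' -> [/\ a = a', b = b', c = c' & d = d'].
Proof. by move=> nz nz' e; apply: mx2_inj; rewrite -!glE // e. Qed.

Local Notation Z := ('Z('GL_2[F]))%g.

Lemma centre_GL2 u : (u \in Z) <-> exists2 k, k != 0 & u = gl k 0 0 k.
Proof.
split=> [/centerP[_ cu]|[k nzk ->]].
  case: (glP u) cu => a b c d nz -> cu.
  have n1 : 1 * 1 - 1 * 0 != 0 :> F by rewrite mulr1 mulr0 subr0 oner_eq0.
  have n2 : 1 * 1 - 0 * 1 != 0 :> F by rewrite mulr1 mul0r subr0 oner_eq0.
  have := cu (gl 1 1 0 1) (in_setT _).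
  move/(congr1 (@GLval 2 F)); rewrite !GL_MxE !glE // !mulmx2.
  case/mx2_inj; rewrite !(mulr1, mul1r, mulr0, mul0r, addr0, add0r).
  move=> ec ed _ _.
  have := cu (gl 1 0 1 1) (in_setT _).
  move/(congr1 (@GLval 2 F)); rewrite !GL_MxE !glE // !mulmx2.
  case/mx2_inj; rewrite !(mulr1, mul1r, mulr0, mul0r, addr0, add0r).
  move=> eb _ _ _.
  have c0 : c = 0 by apply/eqP; rewrite -(inj_eq (addrI a)) -ec addr0.
  have b0 : b = 0 by apply/eqP; rewrite -(inj_eq (addrI a)) eb addr0.
  have ead : a = d by apply: (addIr b); rewrite ed addrC.
  rewrite b0 c0 -ead in nz *; exists a => //.
  by apply: contraNneq nz => ->; rewrite !mul0r subr0.
have nz : k * k - 0 * 0 != 0 by rewrite mul0r subr0 mulf_neq0.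
apply/centerP; split=> [|v _]; first exact: in_setT.
case: (glP v) => a b c d nz' ->; rewrite /commute !glM //.
by congr gl; ring.
Qed.

End Coordinates.

(* Inside (...)%g a bare 1 would be the unit of the additive group of F, namely 0. *)
Arguments mx2 {F} (a b c d)%_R.
Arguments gl {F} (a b c d)%_R.

Ltac nz := rewrite ?(mulr0, mul0r, mulr1, mul1r, subr0, sub0r, addr0, add0r,
  oppr_eq0, mulf_eq0, oner_eq0, negb_or, mulrN, mulNr, opprK) //.

(** * The projection from GL(2,F) to PGL(2,F) *)

Section Projection.

Variable F : finFieldType.
Implicit Types (a b c d k x y : F) (u v w : {'GL_2[F]}).
Implicit Types (X Y : coset_of 'Z('GL_2[F])%g).

Local Notation Z := ('Z('GL_2[F]))%g.
Local Notation S := (PSL2 F).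

Definition pgl u : coset_of Z := coset Z u.

Lemma norm_centre_GL2 u : u \in ('N(Z))%g.
Proof. by apply: (subsetP (normal_norm (center_normal _))); rewrite inE. Qed.

Lemma pglM u v : pgl (u * v)%g = (pgl u * pgl v)%g.
Proof. by apply: coset_morphM; apply: norm_centre_GL2. Qed.

Lemma pgl1 : pgl 1%g = 1%g.
Proof. exact/coset_id/group1. Qed.

Lemma pglV u : pgl u^-1%g = (pgl u)^-1%g.
Proof. by apply: (mulgI (pgl u)); rewrite -pglM !mulgV pgl1. Qed.

Lemma pglJ u v : pgl (u ^ v)%g = (pgl u ^ pgl v)%g.
Proof. by rewrite !conjgE !pglM pglV. Qed.

Lemma pglX u n : pgl (u ^+ n)%g = (pgl u ^+ n)%g.
Proof. by elim: n => [|n IHn]; rewrite ?pgl1 // !expgS pglM IHn. Qed.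

Lemma pgl_surj X : exists u, X = pgl u.
Proof. by exists (repr X); rewrite /pgl coset_reprK. Qed.

Lemma pgl_eqP u v :
  (pgl u = pgl v) <-> exists2 k, k != 0 & v = (gl k 0%R 0%R k * u)%g.
Proof.
split=> [e|[k nzk ->]].
  have : (v * u^-1)%g \in Z.
    by apply: coset_idr; rewrite ?norm_centre_GL2 // -/(pgl _) pglM pglV e mulgV.
  by case/centre_GL2=> k nzk e'; exists k => //; rewrite -e' mulgKV.
have /coset_id k1 : gl k 0 0 k \in Z by apply/centre_GL2; exists k.
by rewrite pglM {2}/pgl k1 mul1g.
Qed.

Lemma pgl_gl_eq a b c d a' b' c' d' :
  a * d - b * c != 0 -> a' * d' - b' * c' != 0 ->
  pgl (gl a b c d) = pgl (gl a' b' c' d') ->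
  exists2 k, k != 0 & [/\ a' = k * a, b' = k * b, c' = k * c & d' = k * d].
Proof.
move=> n1 n2 /pgl_eqP[k nzk e]; exists k => //; move: e.
rewrite glM //; last by nz; rewrite nzk.
rewrite !mul0r !addr0 !add0r => /gl_inj[] //.
have := mulf_neq0 (mulf_neq0 nzk nzk) n1; congr (_ != 0); ring.
Qed.

Lemma pgl_scale k a b c d : k != 0 -> a * d - b * c != 0 ->
  pgl (gl (k * a) (k * b) (k * c) (k * d)) = pgl (gl a b c d).
Proof.
move=> nzk n1; apply/esym/pgl_eqP; exists k => //.
by rewrite glM //; [congr gl; ring | nz; rewrite nzk].
Qed.

Lemma pgl_eq1 a b c d : a * d - b * c != 0 ->
  pgl (gl a b c d) = 1%g -> [/\ b = 0, c = 0 & a = d].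
Proof.
move=> n; rewrite -pgl1 -gl1 => /esym/pgl_gl_eq[] //; first by nz.
by move=> k nzk [-> -> -> ->]; rewrite !mulr0 mulr1.
Qed.

Lemma mem_SL2 a b c d : a * d - b * c != 0 ->
  (gl a b c d \in SL2 F) = (a * d - b * c == 1).
Proof. by move=> n; rewrite inE glE // det_mx2. Qed.

Lemma gl_SL2 a b c d : a * d - b * c = 1 -> gl a b c d \in SL2 F.
Proof. by move=> e; rewrite mem_SL2 e ?oner_eq0. Qed.

Lemma PSL2P X : reflect (exists2 u, u \in SL2 F & X = pgl u) (X \in S).
Proof.
apply: (iffP idP) => [/morphimP[u _ Su ->]|[u Su ->]]; first by exists u.
by apply: mem_morphim => //; apply: norm_centre_GL2.
Qed.

Lemma pgl_PSL2 u : u \in SL2 F -> pgl u \in S.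
Proof. by move=> Su; apply/PSL2P; exists u. Qed.

Lemma pgl_sqr_det a b c d k : k != 0 -> a * d - b * c = k * k ->
  pgl (gl a b c d) \in S.
Proof.
move=> nzk e; have n : a * d - b * c != 0 by rewrite e mulf_neq0.
rewrite -(pgl_scale (invr_neq0 nzk) n); apply/pgl_PSL2/gl_SL2.
have -> : k^-1 * a * (k^-1 * d) - k^-1 * b * (k^-1 * c) =
  k^-1 * k^-1 * (a * d - b * c) by ring.
by rewrite e; field.
Qed.

Lemma mem_PGL2 X : X \in PGL2 F.
Proof.
by have [u ->] := pgl_surj X; apply: mem_morphim; rewrite ?norm_centre_GL2 ?inE.
Qed.

Lemma norm_PSL2 X : X \in ('N(S))%g.
Proof. exact: (subsetP (normal_norm (PSL2_normal F))) (mem_PGL2 X). Qed.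

Definition upper x := gl 1 x 0 1.
Definition lower x := gl 1 0 x 1.

Lemma upper_nz x : 1 * 1 - x * 0 != 0 :> F. Proof. by nz. Qed.
Lemma lower_nz x : 1 * 1 - 0 * x != 0 :> F. Proof. by nz. Qed.
Hint Resolve upper_nz lower_nz : core.

Lemma upper_SL2 x : upper x \in SL2 F. Proof. by apply: gl_SL2; ring. Qed.
Lemma lower_SL2 x : lower x \in SL2 F. Proof. by apply: gl_SL2; ring. Qed.

Lemma upperD x y : upper (x + y) = (upper x * upper y)%g.
Proof. by rewrite glM //; congr gl; ring. Qed.

Lemma pgl_upper_inj : injective (pgl \o upper).
Proof.
by move=> x y /pgl_gl_eq[] // k _ []; rewrite mulr1 => <-; rewrite mul1r.
Qed.

Lemma pgl_lower_inj : injective (pgl \o lower).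
Proof.
by move=> x y /pgl_gl_eq[] // k _ []; rewrite mulr1 => <- _; rewrite mul1r.
Qed.

(** Commutation with [upper 1] and [lower 1] holds only up to scalars, but a non-zero off-diagonal
    entry forces such a scalar to be 1, and then that entry vanishes. This makes [conj_aut] faithful
    on PGL(2,F). *)
Lemma cent_PSL2 : ('C(S) = 1)%g.
Proof.
apply/trivgP/subsetP=> X /centP cX; have [u eX] := pgl_surj X; subst X.
case: (glP u) cX => a b c d n -> cX; apply/set1P.
have cU := cX _ (pgl_PSL2 (upper_SL2 1)); have cL := cX _ (pgl_PSL2 (lower_SL2 1)).
move: cU cL; rewrite /commute -!pglM !glM // => cU cL.
case/pgl_gl_eq: cU => [||k nzk [e1 e2 e3 e4]].
- by have := n; congr (_ != 0); ring.
- by have := n; congr (_ != 0); ring.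
case/pgl_gl_eq: cL => [||l nzl [f1 f2 f3 f4]].
- by have := n; congr (_ != 0); ring.
- by have := n; congr (_ != 0); ring.
move: e1 e2 e3 e4 f1 f2 f3 f4.
rewrite !(mulr0, mul0r, mulr1, mul1r, addr0, add0r) => e1 e2 e3 e4 f1 f2 f3 f4.
have c0 : c = 0.
  case: (eqVneq c 0) => // nzc.
  have k1 : k = 1 by apply: (mulIf nzc); rewrite -e3 mul1r.
  by apply: (addrI a); rewrite addr0 e1 k1 mul1r.
have b0 : b = 0.
  case: (eqVneq b 0) => // nzb.
  have l1 : l = 1 by apply: (mulIf nzb); rewrite -f2 mul1r.
  by apply: (addrI a); rewrite addr0 [RHS]f1 l1 mul1r.
rewrite c0 addr0 in e1; rewrite b0 addr0 add0r in e2; rewrite b0 c0 in n *.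
have nza : a != 0 by apply: contraNneq n => ->; rewrite !mul0r subr0.
have k1 : k = 1 by apply: (mulIf nza); rewrite -e1 mul1r.
rewrite e2 k1 mul1r -pgl1 -gl1.
have -> : gl a 0 0 a = gl (a * 1) (a * 0) (a * 0) (a * 1).
  by rewrite mulr1 mulr0.
by apply/eqP; rewrite pgl_scale //; nz.
Qed.

Lemma injm_conj_PSL2 : ('injm (conj_aut S))%g.
Proof. by rewrite ker_conj_aut cent_PSL2. Qed.

End Projection.

Arguments upper {F} x%_R.
Arguments lower {F} x%_R.

(** * Cyclic overgroups in PGL(2,F) *)

Section Cliques.

Variable F : finFieldType.
Implicit Types (a b c d k x y : F) (u v w t : {'GL_2[F]}).
Implicit Types (X Y W T : coset_of 'Z('GL_2[F])%g).

Lemma upperX x n : (upper x ^+ n)%g = upper (x *+ n).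
Proof.
elim: n => [|n IHn]; first by rewrite mulr0n expg0 /upper gl1.
by rewrite expgS IHn mulrS upperD.
Qed.

(** Under this condition the neighbours of [X] all lie in one cyclic group and form a clique, so [X]
    cannot be the centre of a claw. *)
Definition cyclic_over X T :=
  forall Y, cyclic <<[set X; Y]>>%g -> (Y \in <[T]>)%g.

Lemma cyclic_overJ X T g : cyclic_over (X ^ g) (T ^ g) -> cyclic_over X T.
Proof.
move=> h Y cXY; have := h (Y ^ g)%g.
rewrite cycleJ memJ_conjg; apply.
have -> : ([set X ^ g; Y ^ g] = [set X; Y] :^ g)%g by rewrite conjUg !conjg_set1.
by rewrite genJ cyclicJ.
Qed.

(** A power of [w] is a scalar multiple of [u], and scalars are central; so the matrices commute
    exactly, not just up to a scalar. *)
Lemma pgl_power_cent1 u w i : (pgl w ^+ i)%g = pgl u -> (w \in 'C[u])%g.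
Proof.
rewrite -pglX => /esym/pgl_eqP[k nzk ewi].
have /centerP[_ cz] : gl k 0 0 k \in 'Z('GL_2[F])%g by apply/centre_GL2; exists k.
apply/cent1P; have : commute w (gl k 0 0 k * u)%g by rewrite -ewi; apply: commuteX.
have ck : commute w (gl k 0 0 k) by apply/commute_sym/cz; rewrite inE.
by move=> /(commuteM (commuteV ck)); rewrite mulKg => /commute_sym.
Qed.

(** A generator of a cyclic group containing [pgl u] lifts to a matrix centralizing [u], by
    [pgl_power_cent1]. *)
Lemma cyclic_over_centralizer u t :
  (forall v, v \in 'C[u] -> pgl v \in <[pgl t]>)%g -> cyclic_over (pgl u) (pgl t).
Proof.
move=> h Y /cyclicP[W eW]; have [w eww] := pgl_surj W.
have : pgl u \in <[W]>%g by rewrite -eW mem_gen // !inE eqxx.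
have : Y \in <[W]>%g by rewrite -eW mem_gen // !inE eqxx orbT.
rewrite eww => /cycleP[j ->] /cycleP[i /esym/pgl_power_cent1/h wt].
exact: (@groupX _ <[pgl t]>%G).
Qed.

(** These are the elements x u + y of F[u]. The coefficient x is a quotient of off-diagonal entries
    of [t] and [u], or of differences of diagonal entries when [u] is diagonal. *)
Lemma cent1_gl a b c d u : u = gl a b c d -> a * d - b * c != 0 ->
  (b != 0) || (c != 0) || (a != d) ->
  forall t, (t \in 'C[u])%g ->
  exists x y, GLval t = mx2 (x * a + y) (x * b) (x * c) (x * d + y).
Proof.
move=> -> n1 ns t; case: (glP t) => a' b' c' d' n2 -> /cent1P.
move/(congr1 (@GLval 2 F)); rewrite !GL_MxE !glE // !mulmx2.
case/mx2_inj=> e1 e2 e3 _.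
have e1' : b' * c = b * c' by apply: (addrI (a' * a)); rewrite e1; ring.
case: (eqVneq b 0) ns e1' e2 e3 => [-> | nzb _] /=.
  rewrite ?mul0r ?mulr0 ?add0r ?addr0.
  case: (eqVneq c 0) => [-> /= nad _ | nzc _ /eqP].
    rewrite ?mul0r ?mulr0 ?add0r ?addr0 => e2 e3.
    have nz : a - d != 0 by rewrite subr_eq0.
    have b0 : b' = 0.
      by apply: (mulfI nz); rewrite mulr0 mulrBl -e2; ring.
    have c0 : c' = 0.
      by apply: (mulfI nz); rewrite mulr0 mulrBl [a * c']mulrC e3; ring.
    exists ((a' - d') / (a - d)), ((a * d' - a' * d) / (a - d)).
    by rewrite b0 c0; congr mx2; field.
  rewrite mulf_eq0 (negPf nzc) orbF => /eqP -> _ e3.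
  exists (c' / c), (a' - c' / c * a); congr mx2; try by field.
  by apply: (mulfI nzc); rewrite [LHS]mulrC -[d' * c](addKr (c' * a)) e3; field.
move=> e1' e2 e3.
exists (b' / b), (a' - b' / b * a); congr mx2; try by field.
  by apply: (mulfI nzb); rewrite -e1'; field.
apply: (mulfI nzb); have -> : b * d' = a' * b + b' * d - a * b' by rewrite e2; ring.
by field.
Qed.

(** The characteristic polynomial has no root, so F[u] is a field and its multiplicative group, the
    centralizer, is cyclic. *)
Lemma cyclic_over_irreducible a b c d : a * d - b * c != 0 ->
  (forall x, (a - x) * (d - x) != b * c) ->
  exists T, cyclic_over (pgl (gl a b c d)) T.
Proof.
move=> n irr; set u := gl a b c d.
have ns : (b != 0) || (c != 0) || (a != d).
  apply: contraT; rewrite !negb_or !negbK => /andP[/andP[/eqP b0 _] /eqP ad].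
  by have := irr d; rewrite b0 subrr mulr0 mul0r eqxx.
have nzc : c != 0.
  by apply: contraTneq (irr d) => ->; rewrite subrr !mulr0 eqxx.
have C := cent1_gl (erefl u) n ns.
have : cyclic ('C[u])%g.
  (* The criterion asks that t - 1 be invertible when t is not 1. For t = x u + y with x non-zero, a
     singular t - 1 would make (1 - y) / x an eigenvalue of u. *)
  apply: (@div_ring_mul_group_cyclic _ _ 'M[F]_2 (@GLval 2 F)) => // [t|].
    case/setD1P=> nt1 Ct.
    have [x [y et]] := C t Ct.
    rewrite -[1]/(1%:M) mx2_scalar.
    have -> : mx2 1 0 0 1 = - mx2 (-1) 0 0 (-1) :> 'M[F]_2.
      by rewrite -scaleN1r scalemx2; congr mx2; ring.
    rewrite opprK et addmx2 unitmxE det_mx2 unitfE; apply: contra nt1 => /eqP e.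
    have [x0|nzx] := eqVneq x 0.
      move: et e; rewrite x0 !mul0r !add0r mulr0 subr0 => et /eqP.
      rewrite mulf_eq0 orbb => /eqP e.
      apply/eqP/GLval_inj; rewrite et -[RHS]/(1%:M) mx2_scalar.
      by have -> : y = 1 by rewrite -[y](subrK 1) e add0r.
    case/eqP: (irr ((1 - y) / x)); apply: (mulfI (mulf_neq0 nzx nzx)).
    apply/eqP; rewrite -subr_eq0; apply/eqP; rewrite -[RHS]e; field.
    exact: nzx.
  apply/centsP=> t /C[x [y et]] t' /C[x' [y' et']].
  by apply/GLval_inj; rewrite !GL_MxE et et' !mulmx2; congr mx2; ring.
case/cyclicP=> t et; exists (pgl t); apply: cyclic_over_centralizer => v.
by rewrite et => /cycleP[i ->]; rewrite pglX mem_cycle.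
Qed.

Lemma diagX a d i : a * d != 0 -> (gl a 0 0 d ^+ i)%g = gl (a ^+ i) 0 0 (d ^+ i).
Proof.
rewrite mulf_eq0 negb_or => /andP[nza nzd].
elim: i => [|i IHi]; first by rewrite !expr0 gl1 expg0.
rewrite expgS IHi !exprS glM.
- by rewrite !(mulr0, mul0r, addr0, add0r).
- by rewrite mulr0 subr0 mulf_neq0.
- by rewrite mulr0 subr0 mulf_neq0 ?expf_neq0.
Qed.

Lemma cyclic_over_diag a d : a * d != 0 -> a != d ->
  exists T, cyclic_over (pgl (gl a 0 0 d)) T.
Proof.
move=> n ad; have [z [nzz prim _]] := finField_primitive_root F.
have n0 : a * d - 0 * 0 != 0 by rewrite mulr0 subr0.
(* The centralizer is diagonal, and modulo scalars diag(a', d') is diag(a'/d', 1), a power of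
   diag(z, 1). *)
exists (pgl (gl z 0 0 1)); apply: cyclic_over_centralizer => t Ct.
have ns : (0 != 0 :> F) || (0 != 0 :> F) || (a != d) by rewrite ad orbT.
have [x [y]] := cent1_gl (erefl _) n0 ns Ct.
case: (glP t) => a' b' c' d' n' -> ; rewrite glE // !mulr0.
case/mx2_inj=> _ eb ec _; rewrite {}eb {}ec in n' *.
move: (n'); rewrite mul0r subr0 mulf_eq0 negb_or => /andP[nza nzd].
have [|i ei] := prim (a' / d'); first by rewrite mulf_neq0 ?invr_neq0.
have -> : pgl (gl a' 0 0 d') = pgl (gl z 0 0 1 ^+ i)%g.
  rewrite diagX ?mulr1 // expr1n -ei -[RHS](@pgl_scale _ d') //; last first.
    by nz; rewrite nza invr_eq0.
  by apply: (congr1 (@pgl _)); congr gl; field.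
by rewrite pglX mem_cycle.
Qed.

(** Centralizing matrices are scalar multiples of unipotents, so a cyclic overgroup has order
    dividing p and coincides with the group of order p generated by the transvection. *)
Lemma cyclic_over_upper b : b != 0 -> exists T, cyclic_over (pgl (upper b)) T.
Proof.
move=> nzb; have [p p_pr pF] := finPcharP F.
exists (pgl (upper b)) => Y /cyclicP[W eW].
have [w eww] := pgl_surj W.
have : pgl (upper b) \in <[W]>%g by rewrite -eW mem_gen // !inE eqxx.
have : Y \in <[W]>%g by rewrite -eW mem_gen // !inE eqxx orbT.
rewrite eww => Yw Xw.
suff -> : (<[pgl (upper b)]> = <[pgl w]>)%g by [].
have cw : w \in 'C[upper b]%g.
  by case/cycleP: Xw => i /esym/pgl_power_cent1.
have ns : (b != 0) || (0 != 0 :> F) || (1 != 1 :> F) by rewrite nzb.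
have [x [y]] := cent1_gl (erefl (upper b)) (upper_nz b) ns cw.
move=> ew; have wp : (pgl w ^+ p = 1)%g.
  move: ew; case: (glP w) => a' b' c' d' n' -> ; rewrite glE // !mulr0 !mulr1.
  case/mx2_inj=> ea eb ec ed.
  rewrite ec ed -ea in n' *; clear eb ec ea ed.
  have nza : a' != 0 by apply: contraNneq n' => ->; rewrite mul0r mulr0 subrr.
  have -> : gl a' b' 0 a' = gl (a' * 1) (a' * (b' / a')) (a' * 0) (a' * 1).
    by congr gl; field.
  rewrite pgl_scale ?upper_nz // -/(upper _) -pglX upperX -mulr_natr.
  by rewrite (pcharf0 pF) mulr0 /upper gl1 pgl1.
have dw : (#[pgl w]%g %| p)%N by rewrite order_dvdn wp.
have nX : pgl (upper b) != 1%g.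
  by apply: contra_neq nzb => /(pgl_eq1 (upper_nz b))[].
apply/eqP; rewrite eqEcard cycle_subG Xw /= -!orderE.
have dX := dvdn_trans (order_dvdG Xw) dw.
have [_ /(_ _ dX)] := primeP p_pr; rewrite /= order_eq1 (negPf nX) /= => /eqP ->.
by rewrite dvdn_leq // prime_gt0.
Qed.

(** The property is invariant under conjugation. A matrix with an eigenvalue is conjugate to a
    triangular one, which modulo scalars is a transvection or is diagonalizable. *)
Lemma cyclic_over_pgl X : X != 1%g -> exists T, cyclic_over X T.
Proof.
have [u ->] := pgl_surj X; case: (glP u) => a b c d n -> ntX.
have conjX v v' w : (v * w = w * v')%g ->
    (exists T, cyclic_over (pgl v') T) -> exists T, cyclic_over (pgl v) T.
  move=> e [T cT]; exists (T ^ (pgl w)^-1)%g; apply: (@cyclic_overJ _ _ (pgl w)).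
  by rewrite conjgKV -pglJ conjgE e mulKg.
have tri a' b' d' : a' * d' - b' * 0 != 0 -> pgl (gl a' b' 0 d') != 1%g ->
    exists T, cyclic_over (pgl (gl a' b' 0 d')) T.
  move=> n' nt; have [ead|nad] := eqVneq a' d'.
    rewrite -ead in n' nt *.
    have nza : a' != 0 by apply: contraNneq n' => ->; rewrite mul0r mulr0 subrr.
    have e : gl a' b' 0 a' = gl (a' * 1) (a' * (b' / a')) (a' * 0) (a' * 1).
      by congr gl; field.
    rewrite e pgl_scale ?upper_nz // -/(upper _) in nt *; apply: cyclic_over_upper.
    by apply: contraNneq nt => ->; rewrite /upper gl1 pgl1.
  have nz : a' - d' != 0 by rewrite subr_eq0.
  have n0 : a' * d' - 0 * 0 != 0 by rewrite mulr0 in n'; rewrite mulr0.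
  (* The parameter solves a' x + b' = x d', so that [upper x] diagonalizes the matrix. *)
  apply: (conjX _ (gl a' 0 0 d') (upper (- b' / (a' - d')))).
    by rewrite /upper !glM ?upper_nz //; congr gl; field.
  by apply: cyclic_over_diag => //; rewrite mulr0 subr0 in n0.
case: (pickP [pred x | (a - x) * (d - x) == b * c]) => [l /= /eqP el|irr]; last first.
  by apply: cyclic_over_irreducible => // x; rewrite (negbT (irr x)).
case: (eqVneq c 0) => [c0|nzc]; first by rewrite c0 in n ntX *; apply: tri.
have n1 : (l - d) * 0 - 1 * c != 0 by nz.
have n2 : l * (a + d - l) - 1 * 0 != 0.
  by have -> : l * (a + d - l) - 1 * 0 = a * d - b * c by rewrite -el; ring.
have eT : (gl a b c d * gl (l - d) 1 c 0 = gl (l - d) 1 c 0 * gl l 1 0 (a + d - l))%g.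
  have ebc : b * c = (a - l) * (d - l) by rewrite el.
  by rewrite !glM //; congr gl; rewrite ?ebc ?[c * b]mulrC ?ebc; ring.
(* (l - d, c) is an eigenvector for the eigenvalue l. *)
apply: (conjX _ _ _ eT); apply: tri => //; apply: contra ntX => /eqP e1.
apply/eqP; apply: (conjg_inj (pgl (gl (l - d) 1 c 0))).
by rewrite conj1g -e1 -pglJ conjgE eT mulKg.
Qed.

End Cliques.

(** * Claws in enhanced power graphs *)

Section EnhancedPowerGraph.

Variables (gT : finGroupType) (G : {group gT}).
Implicit Types x y z v w : gT.
Local Open Scope group_scope.

(** The identity is dominating, so the centre of a claw is not 1; the hypothesis then makes two of
    its leaves adjacent. *)
Lemma claw_free_of_cliques :
  {in G & &, forall x y z, x != 1 -> cyclic <<[set x; y]>> ->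
     cyclic <<[set x; z]>> -> cyclic <<[set y; z]>>} ->
  claw_free (proper_enhanced_power_graph G).
Proof.
move=> H [f [finj fV fadj]].
have T (a : 'I_1 + 'I_3) : a \in vertices (complete_bipartite 1 3) by rewrite inE.
have VG a : f a \in G by have := fV a (T a); rewrite !inE => /and3P[].
pose x := f (inl 0%R); pose y := f (inr 0%R); pose z := f (inr 1%R).
have nx1 : x != 1.
  have := fV _ (T (inl 0%R)); rewrite !inE => /and3P[_ _]; rewrite -/x.
  apply: contra => /eqP->; rewrite /dominating /= group1 /=.
  apply/forall_inP=> u Gu; apply/implyP=> nu; rewrite eq_sym nu /=.
  have -> : <<[set 1; u]>> = <[u]>.
    apply/eqP; rewrite eqEsubset gen_subG subUset !sub1set group1 cycle_id.
    by rewrite cycle_subG mem_gen // !inE eqxx orbT.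
  exact: cycle_cyclic.
have := fadj _ _ (T (inl 0%R)) (T (inr 0%R)).
have := fadj _ _ (T (inl 0%R)) (T (inr 1%R)).
have := fadj _ _ (T (inr 0%R)) (T (inr 1%R)).
rewrite /= -/x -/y -/z => /negbT nyz /andP[_ cxz] /andP[_ cxy].
have nyz' : y != z by apply/eqP=> /(finj _ _ (T _) (T _)).
by case/negP: nyz; rewrite nyz' /= (H x y z) ?VG.
Qed.

Lemma cyclic_gen_set2 x : cyclic <<[set x; x]>>.
Proof. by rewrite setUid cycle_cyclic. Qed.

(** The leaves are non-dominating because they are pairwise non-adjacent; [y] is there to make the
    centre [z] non-dominating. *)
Lemma claw_exists z v0 v1 v2 y :
  z \in G -> v0 \in G -> v1 \in G -> v2 \in G -> y \in G ->
  cyclic <<[set z; v0]>> -> cyclic <<[set z; v1]>> -> cyclic <<[set z; v2]>> ->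
  ~~ cyclic <<[set v0; v1]>> -> ~~ cyclic <<[set v0; v2]>> ->
  ~~ cyclic <<[set v1; v2]>> -> ~~ cyclic <<[set z; y]>> ->
  ~ claw_free (proper_enhanced_power_graph G).
Proof.
move=> Gz G0 G1 G2 Gy c0 c1 c2 n01 n02 n12 nzy; apply.
have neq u w : ~~ cyclic <<[set u; w]>> -> u != w.
  by apply: contraNneq => ->; apply: cyclic_gen_set2.
have n10 : ~~ cyclic <<[set v1; v0]>> by rewrite setUC.
have n20 : ~~ cyclic <<[set v2; v0]>> by rewrite setUC.
have n21 : ~~ cyclic <<[set v2; v1]>> by rewrite setUC.
have zneq u w : ~~ cyclic <<[set u; w]>> -> cyclic <<[set z; w]>> -> z != u.
  by move=> nuw czw; apply: contraNneq nuw => <-.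
have nd u w : u \in G -> w \in G -> ~~ cyclic <<[set u; w]>> ->
    u \in G :&: [set v in G | ~~ dominating (enhanced_power_graph G) v].
  move=> Gu Gw nuw; rewrite !inE Gu /=; apply/negP=> /andP[_ /forall_inP /(_ w Gw)].
  by rewrite /= eq_sym (neq _ _ nuw) (negPf nuw).
pose v (i : 'I_3) := nth v0 [:: v0; v1; v2] i.
exists (fun a => match a with inl _ => z | inr i => v i end).
have zv i : (z != v i) && cyclic <<[set z; v i]>>.
  case: i => [[|[|[|?]]] ?] //=; rewrite /v /=.
  - by rewrite c0 (zneq _ _ n01 c1).
  - by rewrite c1 (zneq _ _ n10 c0).
  - by rewrite c2 (zneq _ _ n20 c0).
have vv i j : i != j -> ~~ cyclic <<[set v i; v j]>>.
  by case: i => [[|[|[|?]]] ?] //=; case: j => [[|[|[|?]]] ?] //=.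
split=> /=.
- move=> [i|i] [j|j] _ _ //.
  + by rewrite !ord1.
  + by move=> e; case/andP: (zv j); rewrite e eqxx.
  + by move=> e; case/andP: (zv i); rewrite e eqxx.
  + move=> e; congr inr; apply/eqP; apply/negPn/negP=> /vv.
    by rewrite e cyclic_gen_set2.
- move=> [i|[[|[|[|?]]] ?]] _ //=; rewrite /v /=; [exact: nd nzy
    | exact: nd n01 | exact: nd n12 | exact: nd n20].
- move=> [i|i] [j|j] _ _ /=.
  + by rewrite eqxx.
  + exact: zv.
  + by rewrite eq_sym setUC zv.
  + have [->|/vv /negPf ->] := eqVneq i j; first by rewrite eqxx.
    by rewrite andbF.
Qed.

End EnhancedPowerGraph.

(** * Claw-freeness inside PGL(2,F) *)

Section SubPGL.

Variable F : finFieldType.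

Lemma cyclic_conj_PSL2 (X Y : coset_of 'Z('GL_2[F])%g) :
  cyclic <<[set conj_aut (PSL2 F) X; conj_aut (PSL2 F) Y]>>%g
  = cyclic <<[set X; Y]>>%g.
Proof.
have sN (A : {set coset_of 'Z('GL_2[F])%g}) : A \subset 'N(PSL2 F)%g.
  by apply/subsetP=> t _; apply: norm_PSL2.
rewrite -(injm_cyclic (injm_conj_PSL2 F)) ?morphim_gen ?sN //.
by rewrite morphimU !morphim_set1 ?norm_PSL2.
Qed.

Lemma sub_PGL2_claw_free (G : {group {perm coset_of 'Z('GL_2[F])%g}}) :
  G \subset PGL2_in_Aut F -> claw_free (proper_enhanced_power_graph G).
Proof.
move=> sG; apply: claw_free_of_cliques => x y z.
move=> /(subsetP sG)/morphimP[X NX _ ->] /(subsetP sG)/morphimP[Y NY _ ->].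
move=> /(subsetP sG)/morphimP[W NW _ ->].
rewrite !cyclic_conj_PSL2 => nx1.
have ntX : X != 1%g by apply: contraNneq nx1 => ->; rewrite morph1.
have [T cT] := cyclic_over_pgl ntX.
move=> /cT TY /cT TW; apply: cyclicS (cycle_cyclic T).
by rewrite gen_subG subUset !sub1set TY.
Qed.

End SubPGL.

(** * Automorphisms of PSL(2,F) *)

Section Unipotent.

Variables (F : finFieldType) (p n : nat).
Hypotheses (p_prime : prime p) (card_F : #|F| = (p ^ n)%N).
Implicit Types (a b c d k x y : F) (u v w t : {'GL_2[F]}).
Implicit Types (X Y W T : coset_of 'Z('GL_2[F])%g).

Definition unipotent : {set {'GL_2[F]}} := [set upper x | x : F].

Lemma unipotent_group_set : group_set unipotent.
Proof.
apply/group_setP; split=> [|_ _ /imsetP[x _ ->] /imsetP[y _ ->]].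
  by apply/imsetP; exists 0; rewrite // /upper gl1.
by rewrite -upperD; apply/imsetP; exists (x + y).
Qed.

Canonical unipotent_group := Group unipotent_group_set.

Lemma card_unipotent : #|unipotent| = #|F|.
Proof.
rewrite card_imset // => x y e; apply: pgl_upper_inj.
by rewrite /= e.
Qed.

(** The order of GL(2,q) is q (q - 1)^2 (q + 1), whose p-part is q. *)
Lemma unipotent_Sylow : (p.-Sylow('GL_2[F]) unipotent)%g.
Proof.
rewrite pHallE subsetT /= card_unipotent card_GL_2 card_F.
have q1 : (1 < p ^ n)%N by rewrite -card_F card_finNzRing_gt1.
have pq : (p %| p ^ n)%N by rewrite dvdn_exp // (card_finField_exp_gt0 card_F).
have p1 : (p %| 1)%N = false by rewrite dvdn1 gtn_eqF ?prime_gt1.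
have p'm : (p^').-nat ((p ^ n).-1 ^ 2 * (p ^ n).+1)%N.
  rewrite pnatM pnatX ?orbF !p'natE //.
  rewrite -addn1 dvdn_addr // p1 andbT -subn1.
  by rewrite dvdn_subr ?(ltnW q1) // p1.
have /andP[m_gt0 _] := p'm.
rewrite -mulnA partnM ?(ltnW q1) // (part_p'nat p'm) muln1.
by rewrite part_pnat_id // pnatX pnat_id.
Qed.

Definition upperP : {group coset_of 'Z('GL_2[F])%g} :=
  (unipotent / 'Z('GL_2[F]))%G.

Lemma upperPP X : reflect (exists x, X = pgl (upper x)) (X \in upperP).
Proof.
apply: (iffP idP) => [/morphimP[_ _ /imsetP[x _ ->] ->]|[x ->]].
  by exists x.
by apply: mem_morphim; rewrite ?norm_centre_GL2 //; apply: imset_f.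
Qed.

Lemma upperP_Sylow : (p.-Sylow(PSL2 F) upperP)%g.
Proof.
apply: (pHall_subl _ (normal_sub (PSL2_normal F))).
  by apply/subsetP=> X /upperPP[x ->]; apply/pgl_PSL2/upper_SL2.
apply: quotient_pHall unipotent_Sylow.
by apply/subsetP=> u _; apply: norm_centre_GL2.
Qed.

End Unipotent.

(** * Semilinear form of the automorphisms *)

Section AutPSL2.

Variable F : finFieldType.
Implicit Types (a b c d k x y : F) (u v w t : {'GL_2[F]}).
Implicit Types (X Y W T : coset_of 'Z('GL_2[F])%g).

Local Notation S := (PSL2 F).

Lemma conj_PSL2E X Y : Y \in S -> conj_aut S X Y = (Y ^ X)%g.
Proof. by move=> SY; rewrite norm_conj_autE ?norm_PSL2. Qed.

Lemma Aut_memE alpha Y : alpha \in Aut S -> (alpha Y \in S) = (Y \in S).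
Proof. by move=> Aa; apply: perm_closed; case/setIdP: Aa. Qed.

Lemma AutM alpha X Y : alpha \in Aut S -> X \in S -> Y \in S ->
  alpha (X * Y)%g = (alpha X * alpha Y)%g.
Proof. by move=> Aa SX SY; rewrite -(autmE Aa) morphM. Qed.

Lemma AutJ alpha X Y : alpha \in Aut S -> X \in S -> Y \in S ->
  alpha (X ^ Y)%g = (alpha X ^ alpha Y)%g.
Proof. by move=> Aa SX SY; rewrite -(autmE Aa) morphJ. Qed.

Lemma conj_conj_PSL2 alpha X : alpha \in Aut S -> X \in S ->
  (conj_aut S X ^ alpha)%g = conj_aut S (alpha X).
Proof.
move=> Aa SX; apply: (@eq_Aut _ S); rewrite ?groupJ ?Aut_aut // => Y SY.
rewrite conjgE !permM.
have SaY : (alpha^-1)%g Y \in S by rewrite Aut_memE ?groupV.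
by rewrite conj_PSL2E // AutJ // permKV conj_PSL2E.
Qed.

(** The factor [upper (- d / c)] clears the lower right entry, after which conjugation turns upper
    unipotents into lower ones. It commutes with upper unipotents, so a correction by it does not
    disturb them. *)
Lemma upper_lowerJ a b c d x : c != 0 -> a * d - b * c != 0 ->
  exists y, (upper x ^ (gl a b c d * upper (- d / c)) = lower y)%g.
Proof.
move=> nzc n; exists (- x * c * c / (a * d - b * c)).
have n' : a * 0 - (b - a * d / c) * c != 0.
  by have := n; congr (_ != 0); field.
have -> : (gl a b c d * upper (- d / c))%g = gl a (b - a * d / c) c 0.
  by rewrite /upper glM ?upper_nz //; congr gl; field.
rewrite conjgE; apply: (mulgI (gl a (b - a * d / c) c 0)).
rewrite !mulgA mulgV mul1g /upper /lower !glM ?upper_nz ?lower_nz //.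
by congr gl; field; rewrite ?n.
Qed.

Lemma upper_diagJ x k : k != 0 -> (upper x ^ gl 1 0 0 k = upper (x * k))%g.
Proof.
move=> nzk; have n : 1 * k - 0 * 0 != 0 by nz.
rewrite conjgE; apply: (mulgI (gl 1 0 0 k)).
rewrite !mulgA mulgV mul1g /upper !glM ?upper_nz //.
by congr gl; field.
Qed.

Lemma lower_diagJ x k : k != 0 -> (lower x ^ gl 1 0 0 k = lower (x / k))%g.
Proof.
move=> nzk; have n : 1 * k - 0 * 0 != 0 by nz.
rewrite conjgE; apply: (mulgI (gl 1 0 0 k)).
rewrite !mulgA mulgV mul1g /lower !glM ?lower_nz //.
by congr gl; field.
Qed.

(** An automorphism permutes the Sylow p-subgroups of S, and these are conjugate in S. *)
Lemma Aut_unipotent_Sylow alpha p n : prime p -> #|F| = (p ^ n)%N ->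
  alpha \in Aut S ->
  exists2 X, X \in S &
    forall x, exists y, (alpha (pgl (upper x)) ^ X^-1 = pgl (upper y))%g.
Proof.
move=> p_pr cF Aa; have sylU := upperP_Sylow p_pr cF.
have sU := pHall_sub sylU.
have : (p.-Sylow(S) (autm Aa @* upperP F))%g.
  by rewrite -{1}(im_autm Aa) injm_pHall ?injm_autm.
case/(Sylow_trans sylU)=> X SX eU; exists X => // x.
apply/upperPP; rewrite -mem_conjg -eU -(autmE Aa); apply: mem_morphim.
  by apply/pgl_PSL2/upper_SL2.
by apply/upperPP; exists x.
Qed.

Definition weyl : {'GL_2[F]} := gl 0 1 (-1) 0.

Lemma weyl_nz : 0 * 0 - 1 * (-1) != 0 :> F. Proof. by nz. Qed.

Lemma weyl_SL2 : weyl \in SL2 F. Proof. by apply: gl_SL2; ring. Qed.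

Lemma upper_weylJ x : (upper x ^ weyl = lower (- x))%g.
Proof.
rewrite conjgE; apply: (mulgI weyl).
rewrite !mulgA mulgV mul1g /lower /upper /weyl !glM ?lower_nz ?upper_nz ?weyl_nz //.
by congr gl; ring.
Qed.

Lemma Aut_normalize alpha p n : prime p -> #|F| = (p ^ n)%N -> alpha \in Aut S ->
  exists X,
    [/\ forall x, exists y, (alpha (pgl (upper x)) ^ X)%g = pgl (upper y),
        forall x, exists y, (alpha (pgl (lower x)) ^ X)%g = pgl (lower y) &
        (alpha (pgl (upper 1)) ^ X)%g = pgl (upper 1)].
Proof.
move=> p_pr cF Aa; have [X SX UX] := Aut_unipotent_Sylow p_pr cF Aa.
have Su x := pgl_PSL2 (upper_SL2 x).
have Sl x := pgl_PSL2 (lower_SL2 x).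
have Sw := pgl_PSL2 weyl_SL2.
have [h hU] := fin_all_exists UX.
have hinj : injective h.
  move=> x y e; apply: pgl_upper_inj; apply: (@perm_inj _ alpha).
  by apply: (conjg_inj X^-1%g); rewrite !hU e.
(* The Weyl element conjugates upper unipotents to lower ones; this conjugate of its image does the
   same for their images. *)
have [g' eg] := pgl_surj (X * alpha (pgl weyl) * X^-1)%g.
case: (glP g') eg => a b c d n1 -> eg.
have Lg x : exists z, (alpha (pgl (lower x)) ^ X^-1)%g = pgl (upper z ^ gl a b c d)%g.
  rewrite -[x]opprK -upper_weylJ pglJ AutJ //.
  exists (h (- x)); rewrite pglJ -hU -eg -!conjgM; congr (_ ^ _)%g.
  by rewrite !mulgA mulVg mul1g.
(* If c = 0, gl a b c d normalizes the upper unipotents, so that alpha would send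
   upper and lower unipotents to the same Sylow subgroup. *)
have nzc : c != 0.
  apply/eqP=> c0; rewrite c0 in n1 eg Lg.
  have [z ez] := Lg 1.
  have nza : a != 0 by apply: contraNneq n1 => ->; rewrite mul0r mulr0 subrr.
  have nzd : d != 0 by apply: contraNneq n1 => ->; rewrite !mulr0 subrr.
  have eu : (upper z ^ gl a b 0 d = upper (z * d / a))%g.
    rewrite conjgE; apply: (mulgI (gl a b 0 d)).
    rewrite !mulgA mulgV mul1g /upper !glM ?upper_nz //.
    by congr gl; field.
  rewrite eu in ez.
  have /codomP[x ex] := injF_onto hinj (z * d / a).
  move: ez; rewrite ex -hU => /conjg_inj /perm_inj /pgl_gl_eq[].
  - exact: lower_nz.
  - exact: upper_nz.
  by move=> k nzk [_ _ /eqP]; rewrite mulr1 eq_sym (negPf nzk).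
pose X1 := (X^-1 * pgl (upper (- d / c)))%g.
have U1 x : exists y, (alpha (pgl (upper x)) ^ X1)%g = pgl (upper y).
  exists (h x); rewrite conjgM hU -pglJ; congr (pgl _).
  by rewrite conjgE -upperD addrC upperD mulKg.
have L1 x : exists y, (alpha (pgl (lower x)) ^ X1)%g = pgl (lower y).
  have [z ez] := Lg x; have [y ey] := upper_lowerJ z nzc n1.
  by exists y; rewrite conjgM ez -pglJ -conjgM ey.
(* A diagonal conjugation rescales the parameters; the factor y0^-1 brings the image of [upper 1]
   back to [upper 1]. *)
have [y0 e0] := U1 1.
have nz0 : y0 != 0.
  apply: contra_neq (oner_neq0 F) => y00; apply: pgl_upper_inj.
  apply: (@perm_inj _ alpha); apply: (conjg_inj X1).
  by rewrite /= e0 y00 /upper gl1 pgl1 -(autmE Aa) morph1 conj1g.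
exists (X1 * pgl (gl 1 0 0 y0^-1))%g; split.
- move=> x; have [y ey] := U1 x; exists (y / y0).
  by rewrite conjgM ey -pglJ upper_diagJ // invr_eq0.
- move=> x; have [y ey] := L1 x; exists (y / y0^-1).
  by rewrite conjgM ey -pglJ lower_diagJ // invr_eq0.
by rewrite conjgM e0 -pglJ upper_diagJ ?invr_eq0 // mulfV.
Qed.

(** [s] is a bare function so that iterates and composites fit. The default of [gl] would apply if
    the new determinant were 0, which cannot happen for a field morphism. *)
Definition glmap (s : F -> F) (u : {'GL_2[F]}) : {'GL_2[F]} :=
  gl (s (GLval u 0 0)) (s (GLval u 0 1)) (s (GLval u 1 0)) (s (GLval u 1 1)).

Lemma glmapE (s : F -> F) a b c d : a * d - b * c != 0 ->
  glmap s (gl a b c d) = gl (s a) (s b) (s c) (s d).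
Proof. by move=> n; rewrite /glmap glE // !mxE. Qed.

Lemma SL2_upper_lower a b c d : c != 0 -> a * d - b * c = 1 ->
  gl a b c d = (upper ((a - 1) / c) * lower c * upper ((d - 1) / c))%g.
Proof.
move=> nzc e; rewrite /upper /lower glM ?upper_nz ?lower_nz //.
rewrite glM ?upper_nz //; last first.
  by have := oner_neq0 F; congr (_ != 0); ring.
have eb : b = (a * d - 1) / c by rewrite -e; field.
by rewrite eb; congr gl; field.
Qed.

Lemma Aut_standard alpha p n : prime p -> #|F| = (p ^ n)%N -> alpha \in Aut S ->
  (forall x, exists y, alpha (pgl (upper x)) = pgl (upper y)) ->
  (forall x, exists y, alpha (pgl (lower x)) = pgl (lower y)) ->
  alpha (pgl (upper 1)) = pgl (upper 1) ->
  exists s : {rmorphism F -> F},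
    {in SL2 F, forall A, alpha (pgl A) = pgl (glmap s A)}.
Proof.
move=> p_pr cF Aa /fin_all_exists[f fU] /fin_all_exists[g gL] e1.
have Su x := pgl_PSL2 (upper_SL2 x).
have Sl x := pgl_PSL2 (lower_SL2 x).
have f1 : f 1 = 1 by apply: pgl_upper_inj; rewrite /= -fU.
have fD : {morph f : x y / x + y}.
  move=> x y; apply: pgl_upper_inj.
  by rewrite /= -fU !upperD !pglM AutM // !fU.
have f0 : f 0 = 0 by apply: (addrI (f 0)); rewrite -fD !addr0.
have g0 : g 0 = 0.
  by apply: pgl_lower_inj; rewrite /= -gL /lower gl1 pgl1 -(autmE Aa) morph1.
have fnz x : x != 0 -> f x != 0.
  apply: contra_neq => fx0; apply: pgl_upper_inj; apply: (@perm_inj _ alpha).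
  by rewrite /= !fU fx0 f0.
(* These monomial elements are products of three unipotents, so their images are expressed by f and
   g. *)
pose w x := gl 0 x (- x^-1) 0 : {'GL_2[F]}.
have w_nz x : x != 0 -> 0 * 0 - x * (- x^-1) != 0.
  by move=> nzx; have := oner_neq0 F; congr (_ != 0); field.
have w_SL2 x : x != 0 -> w x \in SL2 F by move=> nzx; apply: gl_SL2; field.
have wE x : x != 0 -> w x = (upper x * lower (- x^-1) * upper x)%g.
  move=> nzx; rewrite /upper /lower glM ?upper_nz ?lower_nz //.
  rewrite glM ?upper_nz //; last by have := oner_neq0 F; congr (_ != 0); ring.
  by congr gl; field.
have aw0 x : x != 0 -> alpha (pgl (w x)) =
    pgl (upper (f x) * lower (g (- x^-1)) * upper (f x))%g.
  by move=> nzx; rewrite wE // !pglM !AutM ?fU ?gL // groupM.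
(* w x conjugates upper unipotents to lower ones, hence so does its image, which
   forces the diagonal entries 1 + (f x) (g (-1/x)) of that image to vanish. *)
have gV x : x != 0 -> g (- x^-1) = - (f x)^-1.
  move=> nzx.
  have := aw0 x nzx; set s := f x; set t := g _ => ew.
  have eJ : (upper 1 * w x = w x * lower (- (x * x)^-1))%g.
    rewrite /upper /lower !glM ?upper_nz ?lower_nz ?w_nz //.
    by congr gl; field.
  have : (pgl (upper 1) * alpha (pgl (w x)) =
          alpha (pgl (w x)) * pgl (lower (g (- (x * x)^-1))))%g.
    by rewrite -e1 -gL -!AutM ?pgl_PSL2 ?w_SL2 ?upper_SL2 ?lower_SL2 // -!pglM eJ.
  set z := g (- (x * x)^-1).
  have n1 : (1 + s * t) * (1 + s * t) - (s + s + s * t * s) * t != 0.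
    by have := oner_neq0 F; congr (_ != 0); ring.
  have -> : alpha (pgl (w x)) = pgl (gl (1 + s * t) (s + s + s * t * s) t (1 + s * t)).
    rewrite ew /upper /lower; congr (pgl _).
    rewrite glM ?upper_nz ?lower_nz // glM ?upper_nz //; last first.
      by have := oner_neq0 F; congr (_ != 0); ring.
    by congr gl; ring.
  rewrite -!pglM /upper /lower !glM ?upper_nz ?lower_nz // => /pgl_gl_eq[].
  - by have := n1; congr (_ != 0); ring.
  - by have := n1; congr (_ != 0); ring.
  move=> k nzk []; rewrite !(mulr0, mul0r, mulr1, mul1r, addr0, add0r).
  move=> _ E1 _ E2.
  have [e|ne] := eqVneq (1 + s * t) 0.
    apply: (mulfI (fnz x nzx)); rewrite -/s mulrN mulfV ?fnz //.
    by apply: (addrI 1); rewrite e subrr.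
  have k1 : k = 1 by apply: (mulIf ne); rewrite -E2 mul1r.
  case/eqP: ne; rewrite k1 mul1r in E1.
  by apply: (addrI (s + s + s * t * s)); rewrite addr0 [RHS]E1.
have aw x : x != 0 -> alpha (pgl (w x)) = pgl (w (f x)).
  by move=> nzx; rewrite aw0 // gV // -wE ?fnz.
(* The torus element diag(x, 1/x) is w(x) w(1)^-1, which determines its image. *)
pose h x := gl x 0 0 x^-1 : {'GL_2[F]}.
have h_nz x : x != 0 -> x * x^-1 - 0 * 0 != 0.
  by move=> nzx; have := oner_neq0 F; congr (_ != 0); field.
have hE x : x != 0 -> (h x * w 1%R = w x)%g.
  move=> nzx; rewrite /h /w glM ?w_nz ?h_nz ?oner_neq0 //.
  by congr gl; rewrite ?invr1; ring.
have h_SL2 x : x != 0 -> h x \in SL2 F.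
  by move=> nzx; apply: gl_SL2; field.
have ah x : x != 0 -> alpha (pgl (h x)) = pgl (h (f x)).
  move=> nzx; apply: (mulIg (pgl (w 1))).
  rewrite -pglM hE ?fnz // -aw // -(hE x) // pglM.
  rewrite AutM ?pgl_PSL2 ?h_SL2 ?w_SL2 ?oner_neq0 //.
  by rewrite aw ?oner_neq0 // f1.
have hU x y : x != 0 -> (h x * upper y = upper (x * x * y) * h x)%g.
  move=> nzx; rewrite /h /upper !glM ?upper_nz ?h_nz //.
  by congr gl; field.
have fQ x y : f (x * x * y) = f x * f x * f y.
  have [->|nzx] := eqVneq x 0; first by rewrite !mul0r f0 !mul0r.
  apply: pgl_upper_inj => /=; rewrite -fU; apply: (mulIg (pgl (h (f x)))).
  rewrite -pglM -hU ?fnz // -ah // -AutM ?pgl_PSL2 ?h_SL2 ?upper_SL2 // -pglM -hU //.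
  by rewrite !pglM AutM ?pgl_PSL2 ?h_SL2 ?upper_SL2 // ah // fU.
have [s es] := square_additive_morphism p_pr cF fD f1 fQ.
exists s => A; case: (glP A) => a b c d n1 -> {A}.
have sU x : alpha (pgl (upper x)) = pgl (upper (s x)) by rewrite es fU.
have sL x : alpha (pgl (lower x)) = pgl (lower (s x)).
  rewrite gL; congr (pgl (lower _)); rewrite es.
  have [->|nzx] := eqVneq x 0; first by rewrite g0 f0.
  (* [gV] at -1/x gives g(x) = -1/f(-1/x), which is f(x) because f is the field morphism s. *)
  have nzV : - x^-1 != 0 by rewrite oppr_eq0 invr_eq0.
  have := gV _ nzV; rewrite invrN invrK opprK => ->.
  by rewrite -!es rmorphN fmorphV invrN invrK opprK.
have main a' b' c' d' : c' != 0 -> a' * d' - b' * c' = 1 ->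
    alpha (pgl (gl a' b' c' d')) = pgl (gl (s a') (s b') (s c') (s d')).
  move=> nzc e; rewrite SL2_upper_lower // !pglM !AutM ?groupM // !sU sL.
  rewrite -!pglM.
  rewrite [in RHS]SL2_upper_lower ?fmorph_eq0 //; last first.
    by rewrite -!rmorphM -rmorphB e rmorph1.
  by rewrite !fmorph_div !rmorphB rmorph1.
rewrite mem_SL2 // => /eqP e; rewrite glmapE //.
have [c0|nzc] := eqVneq c 0; last exact: main.
(* A lower triangular factor brings the case c = 0 back to the previous one. *)
rewrite c0 in e n1 *.
have nzd : d != 0 by apply: contraNneq n1 => ->; rewrite !mulr0 subrr.
have n2 : s a * s d - s b * s 0 != 0.
  by rewrite -!rmorphM -rmorphB fmorph_eq0.
apply: (mulIg (alpha (pgl (lower 1)))).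
rewrite -AutM ?pgl_PSL2 ?lower_SL2 ?gl_SL2 // -pglM sL rmorph1 -pglM /lower.
rewrite !glM ?lower_nz //.
rewrite main.
- by rewrite !(rmorphD, rmorphM, rmorph0, rmorph1).
- by rewrite mul0r add0r mulr1.
- by rewrite -[RHS]e; ring.
Qed.

Definition acts_semilinearly
    (alpha : {perm coset_of 'Z('GL_2[F])%g}) (s : F -> F) u :=
  {in SL2 F, forall A, alpha (pgl A) = pgl (glmap s A ^ u)%g}.

Lemma Aut_semilinear alpha p n : prime p -> #|F| = (p ^ n)%N -> alpha \in Aut S ->
  exists (s : {rmorphism F -> F}) u, acts_semilinearly alpha s u.
Proof.
move=> p_pr cF Aa; have [X [UX LX X1]] := Aut_normalize p_pr cF Aa.
have Su x := pgl_PSL2 (upper_SL2 x).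
have Sl x := pgl_PSL2 (lower_SL2 x).
pose beta := (alpha * conj_aut S X)%g.
have bE Y : Y \in S -> beta Y = (alpha Y ^ X)%g.
  by move=> SY; rewrite permM conj_PSL2E // Aut_memE.
have Ab : beta \in Aut S by rewrite groupM ?Aut_aut.
have [||| s es] := Aut_standard p_pr cF Ab.
- by move=> x; rewrite bE.
- by move=> x; rewrite bE.
- by rewrite bE.
have [u eu] := pgl_surj X^-1%g.
exists s, u => A SA; rewrite pglJ -eu -es // bE ?pgl_PSL2 //.
by rewrite conjgK.
Qed.

End AutPSL2.

(** * When two elements generate a cyclic group *)

Section Cyclic.

Variable gT : finGroupType.
Implicit Types x y : gT.
Local Open Scope group_scope.

Lemma noncyclic_noncommuting x y : x * y != y * x -> ~~ cyclic <<[set x; y]>>.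
Proof.
apply: contra => /cyclic_abelian/centsP cxy.
by apply/eqP/cxy; rewrite mem_gen // !inE eqxx ?orbT.
Qed.

(** A cyclic group has at most one subgroup of order 2. *)
Lemma noncyclic_involutions x y : #[x] = 2 -> #[y] = 2 -> x != y ->
  ~~ cyclic <<[set x; y]>>.
Proof.
move=> ox oy; apply: contra => cxy.
have : <[x]> :==: <[y]>.
  rewrite (eq_subG_cyclic cxy) -?orderE ?ox ?oy //.
  - by rewrite cycle_subG mem_gen // !inE eqxx.
  - by rewrite cycle_subG mem_gen // !inE eqxx orbT.
rewrite !cycle2g // => /eqP/setP/(_ x); rewrite !inE eqxx orbT.
by case: eqP ox => [->|_ _ /esym //]; rewrite order1.
Qed.

Lemma cyclic_coprime_commuting x y : commute x y -> coprime #[x] #[y] ->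
  cyclic <<[set x; y]>>.
Proof.
move=> cxy co; have cc : <[y]> \subset 'C(<[x]>).
  by apply/centsP=> _ /cycleP[i ->] _ /cycleP[j ->]; apply/commuteX2/commute_sym.
have := cyclicM (cycle_cyclic x) (cycle_cyclic y) cc co.
rewrite -cent_joinEr //; apply: cyclicS; rewrite gen_subG subUset !sub1set.
by rewrite !mem_gen // !inE cycle_id ?orbT.
Qed.

Lemma cyclic_gen_power x y : y \in <[x]> -> cyclic <<[set x; y]>>.
Proof.
move=> yx; apply: cyclicS (cycle_cyclic x).
by rewrite gen_subG subUset !sub1set cycle_id.
Qed.

Lemma order_prime_exponent x r : prime r -> x ^+ r = 1 -> x != 1 -> #[x] = r.
Proof.
move=> r_pr /eqP; rewrite -order_dvdn => dv nx.
have [_ /(_ _ dv)] := primeP r_pr.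
by rewrite /= order_eq1 (negPf nx) /= => /eqP.
Qed.

End Cyclic.

(** * Claws outside PGL(2,F) *)

Section Semilinear.

Variable F : finFieldType.
Implicit Types (a b c d k x y : F) (u v w : {'GL_2[F]}).
Implicit Types (X Y W T : coset_of 'Z('GL_2[F])%g).
Implicit Types (s t : {rmorphism F -> F}).
Implicit Types alpha beta : {perm coset_of 'Z('GL_2[F])%g}.

Local Notation S := (PSL2 F).

Lemma glmap_det s a b c d : a * d - b * c != 0 -> s a * s d - s b * s c != 0.
Proof. by move=> n; rewrite -!rmorphM -rmorphB fmorph_eq0. Qed.

Lemma glmap_SL2 s u : u \in SL2 F -> glmap s u \in SL2 F.
Proof.
case: (glP u) => a b c d n ->; rewrite mem_SL2 // => /eqP e.
by rewrite glmapE //; apply: gl_SL2; rewrite -!rmorphM -rmorphB e rmorph1.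
Qed.

Lemma glmapM s u v : glmap s (u * v)%g = (glmap s u * glmap s v)%g.
Proof.
case: (glP u) => a b c d n ->; case: (glP v) => a' b' c' d' n' ->.
rewrite glM // !glmapE ?glM ?glmap_det // ?rmorphD ?rmorphM //.
by have := mulf_neq0 n n'; congr (_ != 0); ring.
Qed.

Lemma glmapV s u : glmap s u^-1%g = (glmap s u)^-1%g.
Proof.
apply: (mulgI (glmap s u)); rewrite -glmapM !mulgV -gl1 glmapE ?upper_nz //.
by rewrite rmorph0 rmorph1.
Qed.

Lemma glmapJ s u v : glmap s (u ^ v)%g = (glmap s u ^ glmap s v)%g.
Proof. by rewrite !conjgE !glmapM glmapV. Qed.

Lemma glmap_comp s t u : glmap (t \o s) u = glmap t (glmap s u).
Proof. by case: (glP u) => a b c d n ->; rewrite !glmapE ?glmap_det. Qed.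

Lemma glmap_id (f : F -> F) u : f =1 id -> glmap f u = u.
Proof. by move=> fid; case: (glP u) => a b c d n ->; rewrite glmapE ?fid. Qed.

Lemma SL2J u v : ((u ^ v)%g \in SL2 F) = (u \in SL2 F).
Proof.
case: (glP u) => a b c d n ->; case: (glP v) => a' b' c' d' n' ->.
rewrite !inE conjgE !GL_MxE !det_mulmx mulrCA -det_mulmx -GL_MxE.
by rewrite mulVg GL_1E det1 mulr1.
Qed.

Lemma semilinearM alpha beta s t u v :
  acts_semilinearly alpha s u -> acts_semilinearly beta t v ->
  acts_semilinearly (alpha * beta)%g (t \o s) (glmap t u * v)%g.
Proof.
move=> ha hb A SA; rewrite permM ha // hb ?SL2J ?glmap_SL2 //.
by rewrite glmapJ -conjgM glmap_comp.
Qed.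

Lemma semilinear_conj v : acts_semilinearly (conj_aut S (pgl v)) idfun v.
Proof.
by move=> A SA; rewrite conj_PSL2E ?pgl_PSL2 // glmap_id // pglJ.
Qed.

Lemma semilinear_eq alpha beta (f : F -> F) u :
  alpha \in Aut S -> beta \in Aut S ->
  acts_semilinearly alpha f u -> acts_semilinearly beta f u -> alpha = beta.
Proof.
move=> Aa Ab ha hb; apply: (eq_Aut Aa Ab) => _ /PSL2P[A SA ->].
by rewrite ha // hb.
Qed.

(** The matrix u v^-1 conjugates each [upper (s x)] to [upper x]. Hence it is upper triangular with
    a x = s(x) d, and x = 1 gives a = d. So elements of PGL(2,F) have trivial field part. *)
Lemma semilinear_field_unique alpha s u v :
  acts_semilinearly alpha s u -> acts_semilinearly alpha idfun v -> s =1 id.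
Proof.
move=> h1 h2.
have E x : pgl (upper (s x) ^ (u * v^-1))%g = pgl (upper x).
  have := h1 _ (upper_SL2 x); rewrite h2 ?upper_SL2 // glmap_id // /upper.
  rewrite glmapE ?upper_nz // rmorph0 rmorph1 !pglJ => e.
  by rewrite pglM pglV conjgM -e conjgK.
case: (glP (u * v^-1)%g) E => a b c d n -> E.
have E' x : exists2 k, k != 0 & [/\ a + b * 0 = k * (a + s x * c),
     a * x + b = k * (b + s x * d), c = k * c & c * x + d = k * d].
  have e : (pgl (upper (s x) * gl a b c d) = pgl (gl a b c d * upper x))%g.
    by rewrite [RHS]pglM -(E x) -pglM conjgE mulKVg.
  move: e; rewrite /upper !glM ?upper_nz // => /pgl_gl_eq[].
  - by have := n; congr (_ != 0); ring.
  - by have := n; congr (_ != 0); ring.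
  move=> k nzk [e1 e2 e3 e4]; exists k => //; split; move: e1 e2 e3 e4;
    by rewrite ?(mulr0, mul0r, mulr1, mul1r, addr0, add0r).
have c0 : c = 0.
  have [//|nzc] := eqVneq c 0.
  have [k nzk [_ _ e3 e4]] := E' 1.
  have k1 : k = 1 by apply: (mulIf nzc); rewrite -e3 mul1r.
  by apply: (addIr d); rewrite add0r -[RHS]mul1r -[in RHS]k1 -e4 mulr1.
rewrite c0 in n E'.
have nza : a != 0 by apply: contraNneq n => ->; rewrite mul0r mulr0 subrr.
have nzd : d != 0 by apply: contraNneq n => ->; rewrite !mulr0 subrr.
have E2 x : a * x = s x * d.
  have [k nzk [e1 e2 _ _]] := E' x.
  have k1 : k = 1.
    by apply: (mulIf nza); rewrite mul1r -[RHS]addr0 -(mulr0 b) e1 mulr0 addr0.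
  by apply: (addIr b); rewrite e2 k1 mul1r addrC.
move=> x; have ad : a = d by have := E2 1; rewrite rmorph1 mulr1 mul1r.
by apply: (mulIf nzd); rewrite -E2 ad mulrC.
Qed.

Lemma semilinear_conjM alpha s u v :
  acts_semilinearly alpha s u ->
  acts_semilinearly (alpha * conj_aut S (pgl v))%g s (u * v)%g.
Proof.
move=> ha A SA; rewrite permM ha // conj_PSL2E ?pgl_PSL2 ?SL2J ?glmap_SL2 //.
by rewrite -pglJ conjgM.
Qed.

Lemma semilinearX beta s u i : acts_semilinearly beta s u ->
  exists (t : {rmorphism F -> F}) v,
    t =1 iter i s /\ acts_semilinearly (beta ^+ i)%g t v.
Proof.
move=> hb; elim: i => [|i [t [v [et ht]]]].
  exists idfun, 1%g; split=> // A SA.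
  by rewrite expg0 perm1 glmap_id // conjg1.
exists (s \o t), (glmap s v * u)%g; split; first by move=> x; rewrite /= et.
by rewrite expgSr; apply: semilinearM.
Qed.

Lemma mem_PGL2_in_AutP alpha : reflect (exists v, alpha = conj_aut S (pgl v))
  (alpha \in PGL2_in_Aut F).
Proof.
apply: (iffP idP) => [/morphimP[X _ _ ->]|[v ->]].
  by have [v ->] := pgl_surj X; exists v.
by apply: mem_morphim; rewrite ?norm_PSL2 ?mem_PGL2.
Qed.

(** Take m least with alpha^m in PGL(2,F) and r a prime factor of m. Then beta = alpha^(m/r) is
    outside PGL(2,F), so its field part is non-trivial, while beta^r = alpha^m is inside. *)
Lemma prime_order_field_automorphism p n
    (G : {group {perm coset_of 'Z('GL_2[F])%g}}) :
  prime p -> #|F| = (p ^ n)%N -> (G \subset Aut S)%g ->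
  ~~ (G \subset PGL2_in_Aut F)%g ->
  exists r beta s u, [/\ prime r, beta \in G, acts_semilinearly beta s u,
     ~ s =1 id & iter r s =1 id].
Proof.
move=> p_pr cF sGA /subsetPn[alpha Ga nPa].
have exm : exists m, (0 < m)%N && (alpha ^+ m \in PGL2_in_Aut F)%g.
  by exists #[alpha]%g; rewrite order_gt0 expg_order group1.
case: (ex_minnP exm) => m /andP[m_gt0 Pm] mmin.
have m_gt1 : (1 < m)%N.
  by case: m m_gt0 Pm {mmin} => [|[|m]] //= _; rewrite expg1 (negPf nPa).
set r := pdiv m; have r_pr : prime r by apply: pdiv_prime.
have mr : (m %/ r * r)%N = m by rewrite divnK ?pdiv_dvd.
set beta := (alpha ^+ (m %/ r))%g.
have Gb : beta \in G by rewrite groupX.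
have nPb : (beta \notin PGL2_in_Aut F)%g.
  apply/negP=> Pb; have := mmin (m %/ r)%N.
  rewrite Pb andbT divn_gt0 ?prime_gt0 // dvdn_leq ?pdiv_dvd // => /(_ isT).
  by rewrite leqNgt ltn_Pdiv // prime_gt1.
have [s [u hb]] := Aut_semilinear p_pr cF (subsetP sGA _ Gb).
exists r, beta, s, u; split=> // [sid|x].
  case/negP: nPb; apply/mem_PGL2_in_AutP; exists u.
  apply: (@semilinear_eq _ _ s u); rewrite ?Aut_aut ?(subsetP sGA) //.
  by move=> A SA; rewrite semilinear_conj // !glmap_id.
have [t [v [<- ht]]] := semilinearX r hb.
have /mem_PGL2_in_AutP[w ew] : (beta ^+ r \in PGL2_in_Aut F)%g.
  by rewrite -expgM mr.
rewrite ew in ht; exact: (semilinear_field_unique ht (semilinear_conj w)).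
Qed.

End Semilinear.

(** * Construction of the claws *)

Section Claws.

Variables (F : finFieldType) (G : {group {perm coset_of 'Z('GL_2[F])%g}}).
Hypotheses (sSG : PSL2_in_Aut F \subset G) (sGA : G \subset Aut (PSL2 F)).
Implicit Types (a b c d k x y : F) (u v w : {'GL_2[F]}).
Implicit Types (X Y W T : coset_of 'Z('GL_2[F])%g).
Implicit Types (s t : {rmorphism F -> F}).
Implicit Types alpha beta : {perm coset_of 'Z('GL_2[F])%g}.

Local Notation S := (PSL2 F).
Local Notation conjS := (conj_aut S).

Lemma mem_conj X : X \in S -> conjS X \in G.
Proof.
move=> SX; apply: (subsetP sSG); apply: mem_morphim => //; exact: norm_PSL2.
Qed.

Lemma conjS_inj X Y : conjS X = conjS Y -> X = Y.
Proof. by move/(injmP (injm_conj_PSL2 F)); apply; apply: norm_PSL2. Qed.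

Lemma noncyclic_moved beta X : beta \in G -> X \in S -> beta X != X ->
  ~~ cyclic <<[set beta; conjS X]>>%g.
Proof.
move=> Gb SX; apply: contra => /cyclic_abelian/centsP cbX.
have Ab := subsetP sGA _ Gb.
apply/eqP/conjS_inj; rewrite -conj_conj_PSL2 //; apply/conjg_fixP/commgP.
by apply: cbX; rewrite mem_gen // !inE eqxx ?orbT.
Qed.

(** A matrix of square determinant is in SL(2,F) up to a scalar, so conjugation by it belongs to G
    and can be cancelled. *)
Lemma strip_inner beta s a b c d k : beta \in G -> a * d - b * c = k * k ->
  k != 0 -> acts_semilinearly beta s (gl a b c d) ->
  exists2 beta', beta' \in G & acts_semilinearly beta' s 1%g.
Proof.
move=> Gb e nzk hb; exists (beta * conjS (pgl (gl a b c d)^-1%g))%g.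
  by rewrite groupM // mem_conj // pglV groupV (pgl_sqr_det nzk).
by rewrite -(mulgV (gl a b c d)); apply: semilinear_conjM.
Qed.

(** [beta] has order r and commutes with conjugation by the elements it fixes; as their orders are
    prime to r, it is adjacent to all three. *)
Lemma fixed_claw r beta s X0 X1 X2 : prime r -> beta \in G ->
  acts_semilinearly beta s 1%g -> ~ s =1 id -> iter r s =1 id ->
  X0 \in S -> X1 \in S -> X2 \in S ->
  beta X0 = X0 -> beta X1 = X1 -> beta X2 = X2 ->
  coprime #[X0]%g r -> coprime #[X1]%g r -> coprime #[X2]%g r ->
  ~~ cyclic <<[set X0; X1]>>%g -> ~~ cyclic <<[set X0; X2]>>%g ->
  ~~ cyclic <<[set X1; X2]>>%g ->
  ~ claw_free (proper_enhanced_power_graph G).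
Proof.
move=> r_pr Gb hb nid idr S0 S1 S2 f0 f1 f2 c0 c1 c2 n01 n02 n12.
have Ab := subsetP sGA _ Gb.
(* A transvection whose parameter is moved by s will be a non-neighbour of [beta]. *)
have [x nx] : exists x, s x != x.
  by apply/existsP; apply: contra_notT nid => /existsPn h x; apply/eqP/negPn/h.
have bu : beta (pgl (upper x)) != pgl (upper x).
  rewrite hb ?upper_SL2 // conjg1 /upper glmapE ?upper_nz //.
  by rewrite rmorph0 rmorph1; apply: contra_neq nx => /pgl_upper_inj.
have Su : pgl (upper x) \in S by apply/pgl_PSL2/upper_SL2.
have br : (beta ^+ r = 1)%g.
  apply: (@eq_Aut _ S); rewrite ?groupX ?group1 // => _ /PSL2P[A SA ->].
  rewrite perm1 permX.
  have -> i : iter i beta (pgl A) = pgl (glmap (iter i s) A).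
    elim: i => [|i IHi] /=; first by rewrite glmap_id.
    have [t et] : exists t : {rmorphism F -> F}, t =1 iter i s.
      by have [t [v [et _]]] := semilinearX i hb; exists t.
    have eg f g (B : {'GL_2[F]}) : f =1 g -> glmap f B = glmap g B.
      by move=> fg; rewrite /glmap !fg.
    rewrite IHi -(eg t) // hb ?glmap_SL2 // conjg1 -glmap_comp.
    by congr (pgl _); apply: eg => y /=; rewrite et.
  by rewrite glmap_id.
have nb1 : beta != 1%g by apply: contraNneq bu => ->; rewrite perm1.
have ob := order_prime_exponent r_pr br nb1.
have cyc X : X \in S -> beta X = X -> coprime #[X]%g r ->
    cyclic <<[set beta; conjS X]>>%g.
  move=> SX fX cX; apply: cyclic_coprime_commuting.
    by apply/esym/commgP/conjg_fixP; rewrite conj_conj_PSL2 // fX.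
  by rewrite ob coprime_sym (order_injm (injm_conj_PSL2 F) (norm_PSL2 X)).
apply: (@claw_exists _ G beta (conjS X0) (conjS X1) (conjS X2)
  (conjS (pgl (upper x))));
  by rewrite ?cyclic_conj_PSL2 ?mem_conj ?noncyclic_moved ?cyc.
Qed.

(** By Cayley-Hamilton the matrix squares to the scalar -1; a non-zero off-diagonal entry keeps it
    from being scalar itself. *)
Lemma pgl_trace0_order2 a b c d : a * d - b * c = 1 -> a + d = 0 ->
  (b != 0) || (c != 0) -> #[pgl (gl a b c d)]%g = 2%N.
Proof.
move=> e1 e0 nz; have n1 : a * d - b * c != 0 by rewrite e1 oner_neq0.
apply: order_prime_exponent => //; last first.
  by apply: contraTneq nz => /(pgl_eq1 n1)[-> -> _]; rewrite eqxx.
rewrite expgS expg1 -pglM glM // -pgl1 -gl1.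
have ed : d = - a by apply: (addrI a); rewrite e0 subrr.
rewrite -[RHS](@pgl_scale _ (-1)) ?oppr_eq0 ?oner_neq0 ?upper_nz //.
have em : a * a + b * c = -1 by rewrite -e1 ed; ring.
apply: (congr1 (@pgl _)); congr gl; rewrite ?mulr1 -?em ?ed; ring.
Qed.

Lemma fixed_pgl beta s a b c d : acts_semilinearly beta s 1%g ->
  a * d - b * c = 1 -> s a = a -> s b = b -> s c = c -> s d = d ->
  beta (pgl (gl a b c d)) = pgl (gl a b c d).
Proof.
move=> hb e1 fa fb fc fd.
by rewrite hb ?gl_SL2 // conjg1 glmapE ?e1 ?oner_neq0 // fa fb fc fd.
Qed.

Lemma involution_claw r beta s : prime r -> odd r -> beta \in G ->
  acts_semilinearly beta s 1%g -> ~ s =1 id -> iter r s =1 id ->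
  ~ claw_free (proper_enhanced_power_graph G).
Proof.
(* Integral matrices of determinant 1 and trace 0, pairwise distinct in PGL(2,F)
   in every characteristic. *)
move=> r_pr r_odd Gb hb nid idr.
have e0 : 0 * 0 - 1 * (-1) = 1 :> F by ring.
have e1 : 1 * (-1) - 1 * (- (2)) = 1 :> F by ring.
have e2 : 1 * (-1) - 2 * (-1) = 1 :> F by ring.
have o0 : #[pgl (gl (0 : F) 1 (-1) 0)]%g = 2%N.
  by apply: pgl_trace0_order2; rewrite ?addr0 ?oner_neq0.
have o1 : #[pgl (gl (1 : F) 1 (- (2)) (-1))]%g = 2%N.
  by apply: pgl_trace0_order2; rewrite ?subrr ?oner_neq0.
have o2 : #[pgl (gl (1 : F) 2 (-1) (-1))]%g = 2%N.
  by apply: pgl_trace0_order2; rewrite ?subrr ?oppr_eq0 ?oner_neq0 ?orbT.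
have f1 : s 1 = 1 by rewrite rmorph1.
have f2 : s 2 = 2 by rewrite rmorph_nat.
have fN x : s x = x -> s (- x) = - x by rewrite rmorphN => ->.
apply: (fixed_claw r_pr Gb hb nid idr (pgl_PSL2 (gl_SL2 e0))
  (pgl_PSL2 (gl_SL2 e1)) (pgl_PSL2 (gl_SL2 e2)));
  rewrite ?(fixed_pgl hb) ?fN ?rmorph0 // ?o0 ?o1 ?o2 ?coprime2n //;
  apply: noncyclic_involutions => //; apply/eqP=> /pgl_gl_eq[];
  rewrite ?e0 ?e1 ?e2 ?oner_neq0 // => k _ [+ + _ _].
- by rewrite mulr0 => /eqP; rewrite oner_eq0.
- by rewrite mulr0 => /eqP; rewrite oner_eq0.
rewrite !mulr1 => <- /eqP.
by rewrite -subr_eq0 addrK oner_eq0.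
Qed.

Lemma odd_claw r beta s u : prime r -> odd r -> beta \in G ->
  acts_semilinearly beta s u -> ~ s =1 id -> iter r s =1 id ->
  ~ claw_free (proper_enhanced_power_graph G).
Proof.
move=> r_pr r_odd Gb hb nid idr.
(* beta^2 acts as s^2, which still has order r, up to a matrix whose determinant
   (s D) D is a square. *)
have idr2 : iter r (s \o s) =1 id.
  move=> x; suff -> i y : iter i (s \o s) y = iter i s (iter i s y) by rewrite !idr.
  by elim: i y => //= i IHi y; rewrite IHi -!iterS !iterSr.
have nid2 : ~ (s \o s) =1 id.
  move=> s2; apply: nid => x; rewrite -[RHS]idr -[r]odd_double_half r_odd /=.
  congr (s _); elim: r./2 => // i IHi.
  by rewrite doubleS !iterS -IHi -[RHS]/((s \o s) x) s2.
have hb2 := semilinearM hb hb.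
case: (glP u) hb2 => a b c d n -> hb2.
rewrite glmapE // glM ?glmap_det // in hb2.
have [k nzk ek] : exists2 k, k != 0 & s (a * d - b * c) * (a * d - b * c) = k * k.
  have nzs : s (a * d - b * c) != 0 by rewrite fmorph_eq0.
  suff [k ek] : exists k, s (a * d - b * c) * (a * d - b * c) = k * k.
    by exists k => //; apply: contraNneq (mulf_neq0 nzs n) => k0; rewrite ek k0 mul0r.
  have [[k ek]|nsq] := square_dec (a * d - b * c).
    by exists (s k * k); rewrite ek rmorphM; ring.
  (* A morphism of a finite field is onto, so s D is a non-square when D is. *)
  apply: square_nonsquare => // k; apply/eqP=> ek.
  have [y ey] : exists y, s y = k.
    by have /codomP[y ->] := injF_onto (fmorph_inj s) k; exists y.
  by have /eqP[] := nsq y; apply: (fmorph_inj s); rewrite ek rmorphM ey.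
have [|beta' Gb' hb'] := strip_inner (groupM Gb Gb) _ nzk hb2.
  by rewrite -ek rmorphB !rmorphM; ring.
exact: involution_claw r_pr r_odd Gb' hb' nid2 idr2.
Qed.

(** The leaves have entries in the prime field, hence are fixed; the third is [upper 1] conjugated
    by [lower 1]. Their orders divide the odd prime p, and no two of them commute. *)
Lemma unipotent_claw p beta s : prime p -> odd p -> p \in [pchar F] ->
  beta \in G -> acts_semilinearly beta s 1%g -> ~ s =1 id -> iter 2 s =1 id ->
  ~ claw_free (proper_enhanced_power_graph G).
Proof.
move=> p_pr p_odd pF Gb hb nid idr.
have f1 : s 1 = 1 by rewrite rmorph1.
have f2 : s 2 = 2 by rewrite rmorph_nat.
have f0 : s 0 = 0 by rewrite rmorph0.
have fN x : s x = x -> s (- x) = - x by rewrite rmorphN => ->.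
have e2 : 2 * 0 - 1 * (-1) = 1 :> F by ring.
have n2 : 2 * 0 - 1 * (-1) != 0 :> F by rewrite e2 oner_neq0.
have nu := upper_nz (1 : F); have nl := lower_nz (1 : F).
have ed : 1 * 1 - 1 * 0 = 1 :> F by ring.
have ed' : 1 * 1 - 0 * 1 = 1 :> F by ring.
have eX : (upper (1 : F) ^ lower 1 = gl 2 1 (-1) 0)%g.
  rewrite conjgE; apply: (mulgI (lower 1)); rewrite !mulgA mulgV mul1g.
  by rewrite /upper /lower !glM //; congr gl; ring.
have eL : (upper (-1 : F) ^ weyl F = lower 1)%g by rewrite upper_weylJ opprK.
have cop X : (X ^+ p = 1)%g -> coprime #[X]%g 2.
  move=> Xp; have dX : (#[X]%g %| p)%N by rewrite order_dvdn Xp.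
  by rewrite coprime_sym coprime2n (dvdn_odd dX).
have up (x : F) : (upper x ^+ p = 1)%g.
  by rewrite upperX -mulr_natr (pcharf0 pF) mulr0 /upper gl1.
have su : upper (1 : F) = gl 1 1 0 1 by [].
have sl : lower (1 : F) = gl 1 0 1 1 by [].
apply: (@fixed_claw 2 beta s (pgl (upper 1)) (pgl (lower 1))
  (pgl (gl 2 1 (-1) 0)));
  rewrite ?(pgl_PSL2 (upper_SL2 _)) ?(pgl_PSL2 (lower_SL2 _)) ?(pgl_PSL2 (gl_SL2 e2)) //.
- by apply: (fixed_pgl hb); rewrite ?f1 ?f0 ?ed.
- by apply: (fixed_pgl hb); rewrite ?f1 ?f0 ?ed'.
- by apply: (fixed_pgl hb); rewrite ?fN ?f1 ?f0 ?f2.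
- by apply: cop; rewrite -pglX up pgl1.
- by apply: cop; rewrite -pglX -eL -conjXg up conj1g pgl1.
- by apply: cop; rewrite -pglX -eX -conjXg up conj1g pgl1.
- apply: noncyclic_noncommuting; rewrite -!pglM /upper /lower !glM //.
  apply/eqP=> /pgl_gl_eq[||k _].
  + by have := oner_neq0 F; congr (_ != 0); ring.
  + by have := oner_neq0 F; congr (_ != 0); ring.
  rewrite ?(mulr0, mul0r, mulr1, mul1r, addr0, add0r) => -[e3 e4 _ _].
  move: e3; rewrite -e4 mul1r => /esym/eqP.
  by rewrite -subr_eq0 addrK oner_eq0.
- apply: noncyclic_noncommuting; rewrite -!pglM /upper /lower !glM //.
  apply/eqP=> /pgl_gl_eq[||k _].
  + by have := oner_neq0 F; congr (_ != 0); ring.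
  + by have := oner_neq0 F; congr (_ != 0); ring.
  rewrite ?(mulr0, mul0r, mulr1, mul1r, addr0, add0r) => -[e3 e4 e5 e6].
  by move/eqP: e6; rewrite oppr_eq0 oner_eq0.
- apply: noncyclic_noncommuting; rewrite -!pglM /upper /lower !glM //.
  apply/eqP=> /pgl_gl_eq[||k _].
  + by have := oner_neq0 F; congr (_ != 0); ring.
  + by have := oner_neq0 F; congr (_ != 0); ring.
  rewrite ?(mulr0, mul0r, mulr1, mul1r, addr0, add0r) => -[e3 e4 e5 e6].
  by move/eqP: e4; rewrite -e6 oner_eq0.
Qed.

Lemma torus_claw n beta s : #|F| = (2 ^ n)%N -> (4 < #|F|)%N ->
  beta \in G -> acts_semilinearly beta s 1%g -> ~ s =1 id -> iter 2 s =1 id ->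
  ~ claw_free (proper_enhanced_power_graph G).
Proof.
move=> cF F4 Gb hb nid idr; have ch2 := card_finPcharP cF (isT : prime 2).
have [t [st nz0 nz1]] := fixed_not_prime_field idr ch2 F4.
have char2 (x : F) : x + x = 0 by rewrite -mulr2n -mulr_natr (pcharf0 ch2) mulr0.
have stV : s t^-1 = t^-1 by rewrite fmorphV st.
have f0 : s 0 = 0 by rewrite rmorph0.
(* This entry appears when diag(t, 1/t) is conjugated by [upper 1]; it vanishes only if t^2 = 1,
   that is t = 1 in characteristic 2. *)
pose m := t - t^-1.
have nzm : m != 0.
  apply: contra_neq nz1 => m0; apply: char2_sqr_eq1 => //.
  by rewrite -[X in X * t](subrK t^-1) -/m m0 add0r mulVf.
have sm : s m = m by rewrite rmorphB st stV.
have eA : t * t^-1 - 0 * 0 = 1 by field.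
have eB : t * t^-1 - m * 0 = 1 by field.
have eC : t * t^-1 - 0 * (- m) = 1 by field.
have nA : t * t^-1 - 0 * 0 != 0 by rewrite eA oner_neq0.
have nB : t * t^-1 - m * 0 != 0 by rewrite eB oner_neq0.
have nC : t * t^-1 - 0 * (- m) != 0 by rewrite eC oner_neq0.
have JB : (gl t 0 0 t^-1 ^ upper 1 = gl t m 0 t^-1)%g.
  rewrite conjgE; apply: (mulgI (upper 1)); rewrite !mulgA mulgV mul1g.
  by rewrite /upper !glM ?upper_nz //; congr gl; rewrite /m; ring.
have JC : (gl t 0 0 t^-1 ^ lower 1 = gl t 0 (- m) t^-1)%g.
  rewrite conjgE; apply: (mulgI (lower 1)); rewrite !mulgA mulgV mul1g.
  by rewrite /lower !glM ?lower_nz //; congr gl; rewrite /m; ring.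
(* As q is even, q - 1 is odd. *)
have cop u : (u ^+ #|F|.-1 = 1)%g -> coprime #[pgl u]%g 2.
  move=> uq; have dX : (#[pgl u]%g %| #|F|.-1)%N by rewrite order_dvdn -pglX uq pgl1.
  rewrite coprime_sym coprime2n (dvdn_odd dX) // -subn1 oddB ?(leq_trans _ F4) //.
  by rewrite cF oddX orbF eqn0Ngt (card_finField_exp_gt0 cF).
have tq : t ^+ #|F|.-1 = 1.
  apply: (mulfI nz0); rewrite -exprS prednK ?expf_card ?mulr1 //.
  by rewrite (leq_trans _ F4).
have oA : (gl t 0 0 t^-1 ^+ #|F|.-1 = 1)%g.
  by rewrite diagX ?mulfV ?oner_neq0 // exprVn tq invr1 gl1.
apply: (@fixed_claw 2 beta s (pgl (gl t 0 0 t^-1)) (pgl (gl t m 0 t^-1))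
   (pgl (gl t 0 (- m) t^-1)));
  rewrite ?(pgl_PSL2 (gl_SL2 _)) //.
- by apply: (fixed_pgl hb).
- by apply: (fixed_pgl hb).
- by apply: (fixed_pgl hb); rewrite // rmorphN sm.
- exact: cop.
- by apply: cop; rewrite -JB -conjXg oA conj1g.
- by apply: cop; rewrite -JC -conjXg oA conj1g.
- apply: noncyclic_noncommuting; rewrite -!pglM !glM //.
  apply/eqP=> /pgl_gl_eq[||k _].
  + by have := oner_neq0 F; congr (_ != 0); field.
  + by have := oner_neq0 F; congr (_ != 0); field.
  rewrite ?(mulr0, mul0r, mulr1, mul1r, addr0, add0r) => -[e3 e4 e5 e6].
  case/eqP: nz1; apply: char2_sqr_eq1 => //; apply: (mulfI nzm).
  have k1 : k = 1 by apply: (mulIf (mulf_neq0 nz0 nz0)); rewrite -e3 mul1r.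
  by rewrite mulr1 -{2}[m](divfK nz0) e4 k1; ring.
- apply: noncyclic_noncommuting; rewrite -!pglM !glM //.
  apply/eqP=> /pgl_gl_eq[||k _].
  + by have := oner_neq0 F; congr (_ != 0); field.
  + by have := oner_neq0 F; congr (_ != 0); field.
  rewrite ?(mulr0, mul0r, mulr1, mul1r, addr0, add0r) => -[e3 e4 e5 e6].
  case/eqP: nz1; apply: char2_sqr_eq1 => //; apply: (mulfI nzm).
  have k1 : k = 1 by apply: (mulIf (mulf_neq0 nz0 nz0)); rewrite -e3 mul1r.
  rewrite k1 mul1r in e5; apply: oppr_inj.
  have -> : - (m * (t * t)) = - m * t * t by ring.
  by rewrite e5; field.
- apply: noncyclic_noncommuting; rewrite -!pglM !glM //.
  apply/eqP=> /pgl_gl_eq[||k _].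
  + by have := oner_neq0 F; congr (_ != 0); rewrite /m; field.
  + by have := oner_neq0 F; congr (_ != 0); rewrite /m; field.
  rewrite ?(mulr0, mul0r, mulr1, mul1r, addr0, add0r) => -[e3 e4 _ e6].
  have nzmt : m / t != 0 by rewrite mulf_neq0 ?invr_neq0.
  have nzt2 := mulf_neq0 nz0 nz0.
  (* Commutation up to k forces k = t^2 and then t^2 = t^-2, so t^4 = 1 and t = 1 in characteristic
     2. *)
  have ek : k = t * t by apply: (mulIf nzmt); rewrite -e4; field.
  have h3 : 1 = t * t - m * m.
    by apply: (mulfI nzt2); rewrite mulr1 {1}e3 ek; ring.
  have h6 : t^-1 * t^-1 - m * m = 1.
    by rewrite addrC -mulNr e6 ek; field.
  have h : t * t = t^-1 * t^-1 by apply: (addIr (- (m * m))); rewrite -h3 h6.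
  case/eqP: nz1; do 2!apply: char2_sqr_eq1 => //.
  by rewrite {1}h; field.
Qed.

(** Let x be conjugation by X. From x^beta = x^-1 and beta^2 = x^2, the elements x, beta and x beta
    all have square x^2, the centre of the claw; two of them commute only if x = x^-1. *)
Lemma quaternion_claw beta X : beta \in G -> X \in S -> beta X = X^-1%g ->
  (beta ^+ 2 = conjS (X ^+ 2))%g -> (X ^+ 2 != 1)%g ->
  ~ claw_free (proper_enhanced_power_graph G).
Proof.
move=> Gb SX bX b2 ntX2; have Ab := subsetP sGA _ Gb.
(* Since S has trivial centralizer, some Y does not commute with X^2; it shows that the centre is
   non-dominating. *)
have [Y SY nc] : exists2 Y, Y \in S & (X ^+ 2 * Y != Y * X ^+ 2)%g.
  apply/exists_inP; apply: contraNT ntX2 => /exists_inPn h.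
  have : (X ^+ 2 \in 'C(S))%g.
    by apply/centP=> Y /h; rewrite negbK => /eqP.
  by rewrite cent_PSL2 inE.
set x := conjS X; have Gx : x \in G := mem_conj SX.
have x2 : (x ^+ 2 = conjS (X ^+ 2))%g by rewrite morphX ?norm_PSL2.
have xb : (x ^ beta = x^-1)%g by rewrite conj_conj_PSL2 // bX morphV ?norm_PSL2.
have nxx : x != x^-1%g.
  rewrite eq_sym eq_invg_mul -expg2 x2; apply: contraNneq ntX2 => e.
  by apply/eqP/conjS_inj; rewrite e morph1.
have xbC : (x * beta != beta * x)%g.
  by apply: contraNneq nxx => e; rewrite -xb conjgE e mulKg.
have bx : (beta * x^-1 = x * beta)%g by rewrite -xb conjgE mulKVg.
have xb2 : ((x * beta) ^+ 2 = x ^+ 2)%g.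
  have e2 : (beta ^+ 2 = x ^+ 2)%g by rewrite b2.
  rewrite expgS expg1 -{2}bx mulgA -(mulgA x) -expg2 e2.
  by rewrite -mulgA expg2 mulgK.
apply: (@claw_exists _ G (x ^+ 2)%g x beta (x * beta)%g (conjS Y));
  rewrite ?groupX ?groupM ?mem_conj // ?x2 ?cyclic_conj_PSL2 -?x2.
- by rewrite setUC cyclic_gen_power ?mem_cycle.
- by rewrite setUC cyclic_gen_power // x2 -b2 mem_cycle.
- by rewrite setUC cyclic_gen_power // -xb2 mem_cycle.
- exact: noncyclic_noncommuting.
- apply: noncyclic_noncommuting; apply: contra xbC => /eqP e.
  by apply/eqP/(mulgI x); rewrite e mulgA.
- apply: noncyclic_noncommuting; apply: contra xbC => /eqP e.
  by apply/eqP/(mulIg beta); rewrite -e mulgA.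
exact: noncyclic_noncommuting.
Qed.

Lemma pgl_PSL2_det u k : k != 0 -> \det (GLval u) = k * k -> pgl u \in S.
Proof.
move=> nzk; case: (glP u) => a b c d n ->; rewrite glE // det_mx2.
exact: pgl_sqr_det.
Qed.

(** Changing the lift by a scalar k changes the image by the scalar s k, so lifts such as diag(i,
    1), of determinant other than 1, can be used. *)
Lemma semilinear_PSL2 beta s u v : acts_semilinearly beta s u -> pgl v \in S ->
  beta (pgl v) = pgl (glmap s v ^ u)%g.
Proof.
move=> hb /PSL2P[A SA]; move=> e; rewrite e hb // !pglJ; congr (_ ^ _)%g.
move/pgl_eqP: e => [k nzk ->]; rewrite glmapM.
have n : k * k - 0 * 0 != 0 by nz; rewrite nzk.
rewrite glmapE // rmorph0; apply/esym/pgl_eqP.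
by exists (s k); rewrite ?fmorph_eq0.
Qed.

(** The product of two non-square determinants is a square, so u^-1 v represents an element of S,
    and multiplying by its conjugation replaces [u] by [v]. *)
Lemma nonsquare_coset beta s u v : beta \in G -> acts_semilinearly beta s u ->
  (forall k, \det (GLval u) != k * k) -> (forall k, \det (GLval v) != k * k) ->
  exists2 beta', beta' \in G & acts_semilinearly beta' s v.
Proof.
move=> Gb hb nu nv; have du := GL_det u; have dv := GL_det v.
have [k ek] := square_nonsquare du dv nu nv.
have nzk : k != 0 by apply: contraTneq (mulf_neq0 du dv) => k0; rewrite ek k0 mul0r eqxx.
exists (beta * conjS (pgl (u^-1 * v)))%g; last first.
  by have := semilinear_conjM (u^-1 * v)%g hb; rewrite mulKVg.
rewrite groupM // mem_conj //.
apply: (@pgl_PSL2_det _ (k / \det (GLval u))); first by rewrite mulf_neq0 ?invr_eq0.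
rewrite GL_MxE det_mulmx GL_VxE det_inv.
have -> : k / \det u * (k / \det u) = (k * k) / (\det u * \det u) by field.
by rewrite -ek; field.
Qed.

Lemma twisted_claw beta s u : odd #|F| -> (2 : F) != 0 ->
  beta \in G -> acts_semilinearly beta s u -> ~ s =1 id -> iter 2 s =1 id ->
  (forall k, \det (GLval u) != k * k) ->
  ~ claw_free (proper_enhanced_power_graph G).
Proof.
move=> oF nz2 Gb hb nid sK nsq.
(* The square root of -1 has to be a square for diag(i, 1) to lie in S; hence the eighth root of
   unity. *)
have [i i2 [z ez]] : exists2 i : F, i * i = -1 & exists z, i = z * z.
  have [z z4] := eighth_root_of_unity nid sK nz2 oF.
  by exists (z * z); [rewrite -z4; ring | exists z].
have nzi : i != 0.
  by apply: contraTneq (oner_neq0 F) => i0; rewrite -oppr_eq0 -i2 i0 mul0r eqxx.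
have nzz : z != 0 by apply: contraNneq nzi => z0; rewrite ez z0 mul0r.
have ni : i * 1 - 0 * 0 != 0 by nz.
have ni' : 1 * i - 0 * 0 != 0 by nz.
pose X := pgl (gl i 0 0 1).
have SX : X \in S by apply: (pgl_sqr_det nzz); rewrite ez; ring.
have n1 : -1 * 1 - 0 * 0 != 0 :> F by nz.
have X2 : (X ^+ 2)%g = pgl (gl (-1) 0 0 1).
  rewrite expg2 -pglM glM //; apply: (congr1 (@pgl _)).
  by congr gl; rewrite ?i2; ring.
have ntX2 : (X ^+ 2)%g != 1%g.
  rewrite X2; apply: contraNneq nz2 => /(pgl_eq1 n1)[_ _ e].
  by rewrite -[2]/(1 + 1) -{1}e addNr.
have nV : i^-1 * 1 - 0 * 0 != 0 by nz; rewrite invr_eq0.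
have XV : (X^-1)%g = pgl (gl i^-1 0 0 1).
  apply/eqP; rewrite eq_invg_mul -pglM glM // -pgl1 -gl1.
  by apply/eqP; apply: (congr1 (@pgl _)); congr gl; field.
have ei : i^-1 = - i by apply: (mulfI nzi); rewrite mulfV // mulrN i2 opprK.
(* As s^2 is the identity, the square of [beta'] is conjugation by v^s v. *)
have sq2 (beta' : {perm coset_of 'Z('GL_2[F])%g}) v : beta' \in G ->
    acts_semilinearly beta' s v -> pgl (glmap s v * v)%g = (X ^+ 2)%g ->
    (beta' ^+ 2 = conjS (X ^+ 2))%g.
  move=> Gb' hb' e; have Ab' := subsetP sGA _ Gb'.
  have := semilinearM hb' hb'; rewrite expg2 => h.
  apply: (eq_Aut (groupM Ab' Ab') (Aut_aut _ _)) => _ /PSL2P[A SA ->].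
  by rewrite h // glmap_id // pglJ e conj_PSL2E ?pgl_PSL2.
have : s i = i \/ s i = - i.
  have /eqP : s i * s i = i * i by rewrite -rmorphM i2 rmorphN rmorph1.
  rewrite -subr_eq0 -!expr2 subr_sqr mulf_eq0 subr_eq0 addr_eq0.
  by case/orP => /eqP; [left|right].
(* The field element b with s b = - b is not a square: if c^2 = - b then
   s c = i c up to sign, so that c = s (s c) = i^2 c = - c. *)
case=> si.
  have [b nzb sb] := antifixed nid sK.
  have nb : 0 * 0 - b * 1 != 0 by nz.
  have nsb : 0 * 0 - - b * 1 != 0 by nz.
  have [|beta' Gb' hb'] := nonsquare_coset (v := gl 0 b 1 0) Gb hb nsq.
    move=> c; rewrite glE // det_mx2; apply/eqP=> ec.
    have ec' : c * c = - b by rewrite -ec; ring.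
    have nzc : c != 0 by apply: contraNneq nzb => c0; rewrite -oppr_eq0 -ec' c0 mul0r.
    have : s c * s c = i * c * (i * c).
      rewrite -rmorphM ec' rmorphN sb mulrACA i2 ec'; ring.
    move/eqP; rewrite -subr_eq0 -!expr2 subr_sqr mulf_eq0 subr_eq0 addr_eq0.
    have sc2 : s (s c) = c := sK c.
    have bad : c = i * (i * c) -> False.
      rewrite mulrA i2 mulN1r => e; have /eqP : 2 * c = 0.
        have -> : 2 * c = c + c by ring.
        by rewrite {1}e addNr.
      by rewrite mulf_eq0 (negPf nz2) (negPf nzc).
    case/orP=> /eqP e; apply: bad; rewrite -{1}sc2 e ?rmorphN rmorphM si e //.
    by ring.
  (* The antidiagonal v swaps the entries of diag(i, 1) and so inverts X in PGL(2,F); v^s v =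
     diag(-b, b) is X^2 up to a scalar. *)
  apply: (quaternion_claw Gb' SX _ _ ntX2).
    rewrite (semilinear_PSL2 hb' SX) glmapE // si rmorph0 rmorph1 XV.
    have -> : (gl i 0 0 1 ^ gl 0 b 1 0 = gl 1 0 0 i)%g.
      rewrite conjgE; apply: (mulgI (gl 0 b 1 0)); rewrite !mulgA mulgV mul1g.
      by rewrite !glM //; congr gl; ring.
    rewrite -[RHS](@pgl_scale _ i) //.
    by apply: (congr1 (@pgl _)); congr gl; field.
  apply: (sq2 _ _ Gb' hb'); rewrite glmapE // sb rmorph0 rmorph1 glM // X2.
  rewrite -[RHS](@pgl_scale _ b) //.
  by apply: (congr1 (@pgl _)); congr gl; ring.
(* An element a of norm - 1 is not a square: if a = c^2 then c (s c) = i up to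
   sign is fixed by s, whereas s i = - i. *)
have [x [y [sx sy exy]]] := minus1_sum_of_squares s.
pose a := x + i * y.
have sa : s a = x - i * y by rewrite rmorphD rmorphM si sx sy mulNr.
have saa : s a * a = -1.
  have -> : s a * a = x * x - i * i * (y * y) by rewrite sa /a; ring.
  by rewrite i2 mulN1r opprK.
have nza : a != 0.
  by apply: contraTneq (oner_neq0 F) => a0; rewrite -oppr_eq0 -saa a0 mulr0 eqxx.
have na : a * 1 - 0 * 0 != 0 by nz.
have nsa : s a * 1 - 0 * 0 != 0 by nz; rewrite fmorph_eq0.
have [|beta' Gb' hb'] := nonsquare_coset (v := gl a 0 0 1) Gb hb nsq.
  move=> c; rewrite glE // det_mx2 mulr1 mul0r subr0; apply/eqP=> ec.
  have : s c * c * (s c * c) = i * i by rewrite i2 -saa ec rmorphM; ring.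
  move/eqP; rewrite -subr_eq0 -!expr2 subr_sqr mulf_eq0 subr_eq0 addr_eq0.
  have sN : s (s c * c) = s c * c.
    by rewrite rmorphM mulrC; congr (_ * _); apply: sK.
  have bad : i = - i -> False.
    move=> e; have /eqP : 2 * i = 0.
      have -> : 2 * i = i + i by ring.
      by rewrite {1}e addNr.
    by rewrite mulf_eq0 (negPf nz2) (negPf nzi).
  by case/orP=> /eqP e; apply: bad; move: sN; rewrite e ?rmorphN si ?opprK.
(* Here s itself inverts i and v = diag(a, 1) commutes with diagonal matrices; the norm -1 of a
   gives v^s v = diag(-1, 1). *)
apply: (quaternion_claw Gb' SX _ _ ntX2).
  rewrite (semilinear_PSL2 hb' SX) glmapE // si rmorph0 rmorph1 XV ei.
  have nNi : - i * 1 - 0 * 0 != 0 by nz.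
  have -> : (gl (- i) 0 0 1 ^ gl a 0 0 1 = gl (- i) 0 0 1)%g.
    rewrite conjgE; apply: (mulgI (gl a 0 0 1)); rewrite !mulgA mulgV mul1g.
    by rewrite !glM //; congr gl; ring.
  by [].
apply: (sq2 _ _ Gb' hb'); rewrite glmapE // rmorph0 rmorph1 glM // X2.
by apply: (congr1 (@pgl _)); congr gl; rewrite -?saa; ring.
Qed.

End Claws.

Local Close Scope ring_scope.

Theorem theorem6p3 (p n : nat) (F : finFieldType)
    (p_prime : prime p) (n_ge1 : 1 <= n)
    (card_F : #|F| = p ^ n) (q_ge5 : 5 <= p ^ n)
    (G : {group {perm coset_of 'Z('GL_2[F])%g}})
    (S_sub_G : PSL2_in_Aut F \subset G)
    (G_sub_AutS : G \subset Aut (PSL2 F)) :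
  claw_free (proper_enhanced_power_graph G) <->
  (PSL2_in_Aut F \subset G) /\ (G \subset PGL2_in_Aut F).
Proof.
split=> [cf|[_ sGP]]; last exact: sub_PGL2_claw_free.
split=> //; apply/negPn/negP=> nGP.
have [r [beta [s [u [r_pr Gb hb nid idr]]]]] :=
  prime_order_field_automorphism p_prime card_F G_sub_AutS nGP.
have F4 : 4 < #|F| by rewrite card_F.
have pF := card_finPcharP card_F p_prime.
have [r2|r_odd] := even_prime r_pr; last exact: (odd_claw _ _ r_pr r_odd Gb hb).
rewrite r2 in idr.
case: (square_dec (\det (GLval u)%R)%R) => [[k ek]|nsq].
  have nzk : (k != 0)%R.
    by apply: contraTneq (GL_det u) => k0; rewrite ek k0 mul0r eqxx.
  have [beta' Gb' hb'] : exists2 beta', beta' \in G & acts_semilinearly beta' s 1%g.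
    move: ek hb; case: (glP u) => a b c d n1 ->; rewrite glE // det_mx2 => ek hb.
    exact: (strip_inner S_sub_G Gb ek nzk hb).
  have [p2|p_odd] := even_prime p_prime.
    by rewrite p2 in card_F; apply: (torus_claw _ _ card_F F4 Gb' hb').
  exact: (unipotent_claw _ _ p_prime p_odd pF Gb' hb').
have [p2|p_odd] := even_prime p_prime.
  (* In characteristic 2 every determinant is a square. *)
  rewrite p2 in card_F; have [k ek] := card_pow2_square (\det (GLval u))%R card_F.
  by have := nsq k; rewrite ek eqxx.
apply: (twisted_claw _ _ _ _ Gb hb nid idr nsq cf) => //.
- by rewrite card_F oddX p_odd orbT.
by rewrite -(dvdn_pcharf pF) dvdn_prime2 //; apply: contraTneq p_odd => ->.
Qed.
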